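(* Let $P$ be a point process on $X$ whose Campbell measure admits a Papangelou density $c(x;\omega)$ with respect to $\lambda\otimes P$. Let $n,r\ge 1$ and let $u : X^r \times \Omega^X \to \mathbb{R}$ be a measurable $r$-process such that $u(z_1,\ldots,z_r;\omega)=0$ whenever $z_i=z_j$ for some $1\le i\ne j\le r$, $\omega\in\Omega^X$, and such that both sides of the identity below make sense (i.e. either $u\ge 0$, or the right-hand side with $u$ replaced by $|u|$ is finite). Then $$ \mathbb{E}\left[\left(\int_{X^r} u(z_1,\ldots,z_r;\omega)\,\omega(dz_1)\cdots\omega(dz_r)\right)^n\right] =\sum_{\substack{\rho\in\Pi[n\times r]\\ \rho\wedge\pi=\hat 0}}\mathbb{E}\left[\int_{X^{|\rho|}}\epsilon^+_{\mathfrak{z}_{|\rho|}}\prod_{k=1}^n u\big(z^\rho_{\pi_k}\big)\,\hat\lambda^{|\rho|}(d\mathfrak{z}_{|\rho|})\right], $$ where $z^\rho_{\pi_k}:=(z_{\zeta^\rho(k,1)},\ldots,z_{\zeta^\rho(k,r)})$, $k=1,\ldots,n$.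
   Context: $X$ is a Polish space with Borel $\sigma$-algebra $\mathcal{B}(X)$ and a $\sigma$-finite non-atomic measure $\lambda$. $\Omega^X$ is the space of locally finite configurations $\omega\subset X$ (i.e. $\#(A\cap\omega)<\infty$ for all compact $A$), with $\omega$ identified with the Radon measure $\sum_{x\in\omega}\epsilon_x$ ($\epsilon_x$ = Dirac measure at $x$). A point process is a probability measure $P$ on $\Omega^X$ with the $\sigma$-algebra $\mathcal{F}$ generated by the vague topology; $\mathbb{E}$ is expectation under $P$. The Campbell measure is $C(A\times B)=\mathbb{E}[\int_A \mathbf{1}_B(\omega\setminus\{x\})\,\omega(dx)]$, $A\in\mathcal{B}(X)$, $B\in\mathcal{F}$. The Papangelou density $c$ is defined by $C(dx,d\omega)=c(x;\omega)\,\lambda(dx)\,P(d\omega)$ (absolute continuity is assumed). The compound Campbell density $\hat c$ is defined inductively by $\hat c(\emptyset;\omega)=1$ and $\hat c(\{x_1,\ldots,x_n,y\};\omega)=c(y;\omega)\,\hat c(\{x_1,\ldots,x_n\};\omega\cup\{y\})$, $n\ge0$. For $\mathfrak{x}_n=(x_1,\ldots,x_n)$, $\hat\lambda^n(d\mathfrak{x}_n)=\hat c(\{x_1,\ldots,x_n\};\omega)\,\lambda(dx_1)\cdots\lambda(dx_n)$ is a random measure on $X^n$. For $\mathfrak{z}_m=(z_1,\ldots,z_m)\in X^m$, $\epsilon^+_{\mathfrak{z}_m}$ is the operator that replaces $\omega$ by $\omega\cup\{z_1,\ldots,z_m\}$ in everything it acts on: $(\epsilon^+_{\mathfrak{z}_m}F)(\omega)=F(\omega\cup\{z_1,\ldots,z_m\})$;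 thus $\epsilon^+_{\mathfrak{z}_m}\prod_k u(\cdot)=\prod_k u(\,\cdot\,;\omega\cup\{z_1,\ldots,z_m\})$. The variable $\omega$ in $u$ is omitted. $\Pi[n\times r]$ is the set of all partitions of $\Delta_{n\times r}=\{1,\ldots,n\}\times\{1,\ldots,r\}$, and $\pi=(\pi_1,\ldots,\pi_n)\in\Pi[n\times r]$ is the partition with blocks $\pi_k=\{(k,1),\ldots,(k,r)\}$. For $\rho=\{\rho_1,\ldots,\rho_m\}\in\Pi[n\times r]$, $|\rho|=m$ is the number of blocks, and $\zeta^\rho(k,l)=p$ if and only if $(k,l)\in\rho_p$. $\hat 0$ is the partition of $\Delta_{n\times r}$ into singletons, and $\rho\wedge\pi=\hat 0$ ($\rho$ is ''non-flat'') means $|\pi_k\cap\rho_l|\le1$ for all $k=1,\ldots,n$, $l=1,\ldots,|\rho|$. *)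

(* Defs.v *)
From HB Require Import structures.
From mathcomp Require Import all_boot all_order all_algebra.
Set Implicit Arguments.
Unset Strict Implicit.
Unset Printing Implicit Defensive.

Section partitions.
Local Open Scope nat_scope.
Context (n r : nat).

Definition grid_partition :=
  {rho : {set {set 'I_n * 'I_r}} | partition rho [set: 'I_n * 'I_r]}.

Definition row_block (k : 'I_n) : {set 'I_n * 'I_r} :=
  [set kl | kl.1 == k].

Definition nonflat (rho : grid_partition) : bool :=
  [forall k, forall B in val rho, #|row_block k :&: B| <= 1].

Lemma pblock_grid (rho : grid_partition) kl : pblock (val rho) kl \in val rho.
Proof.
by apply: pblock_mem; rewrite (cover_partition (valP rho)) in_setT.
Qed.

(* The blocks of rho are numbered along [enum]: rho_p is [enum_val p]. *)
Definition zeta (rho : grid_partition) (kl : 'I_n * 'I_r) : 'I_#|val rho| :=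
  enum_rank_in (pblock_grid rho kl) (pblock (val rho) kl).

Lemma zetaP (rho : grid_partition) kl p :
  reflect (zeta rho kl = p) (kl \in enum_val p).
Proof.
have /and3P[_ tI _] := valP rho.
apply: (iffP idP) => [klp|<-].
  apply: enum_val_inj; rewrite enum_rankK_in ?pblock_grid//.
  by apply: def_pblock => //; exact: enum_valP.
rewrite enum_rankK_in ?pblock_grid// mem_pblock.
by rewrite (cover_partition (valP rho)) in_setT.
Qed.

Definition zrow (T : Type) (rho : grid_partition) (z : #|val rho|.-tuple T)
    (k : 'I_n) : r.-tuple T :=
  [tuple tnth z (zeta rho (k, l)) | l < r].

End partitions.
Arguments zrow {n r T} rho z k.

From mathcomp Require Import all_classical all_reals all_analysis.
From mathcomp Require Import measurable_realfun.
Import Order.TTheory GRing.Theory Num.Theory.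
Import numFieldNormedType.Exports.
Local Open Scope classical_set_scope.
Local Open Scope ring_scope.

Definition separable_space (T : topologicalType) : Prop :=
  exists2 D : set T, countable D & dense D.

Definition borel (T : ptopologicalType) := g_sigma_algebraType (@open T).

Definition non_atomic d (T : measurableType d) (R : realType)
    (mu : set T -> \bar R) : Prop :=
  forall A, measurable A -> (0 < mu A)%E ->
  exists B, [/\ measurable B, B `<=` A, (0 < mu B)%E & (mu B < mu A)%E].

Section configurations.
Context (R : realType) (X : completePseudoMetricType R).

Definition locally_finite (w : set X) : Prop :=
  forall A : set X, compact A -> finite_set (A `&` w).

Record config := Config {
  points : set X ;
  points_lf : locally_finite points }.

Lemma locally_finite0 : locally_finite set0.
Proof. by move=> A _; rewrite setI0. Qed.

Lemma locally_finiteU (w : config) (s : seq X) :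
  locally_finite (points w `|` [set` s]).
Proof.
move=> A cA; rewrite setIUr finite_setU; split; first exact: points_lf cA.
exact/finite_setIr/finite_seq.
Qed.

Lemma locally_finiteD1 (w : config) (x : X) : locally_finite (points w `\ x).
Proof.
move=> A cA; apply: sub_finite_set (points_lf w cA).
by apply: setIS; exact: subDsetl.
Qed.

Definition config0 := Config locally_finite0.
Definition config_add (w : config) (s : seq X) := Config (locally_finiteU w s).
Definition config_del (w : config) (x : X) := Config (locally_finiteD1 w x).

HB.instance Definition _ := gen_eqMixin config.
HB.instance Definition _ := gen_choiceMixin config.
HB.instance Definition _ := isPointed.Build config config0.

Section config_measure.
Local Open Scope ereal_scope.
Variable w : config.

(* The Radon measure with which a configuration is identified. *)
Definition config_measure (A : set (borel X)) : \bar R :=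
  \esum_(x in (points w : set (borel X))) \d_x A.

Let config_measure0 : config_measure set0 = 0.
Proof. by rewrite /config_measure esum1// => x _; rewrite measure0. Qed.

Let config_measure_ge0 A : 0 <= config_measure A.
Proof. exact: esum_ge0. Qed.

Let config_measure_sigma_additive : semi_sigma_additive config_measure.
Proof.
move=> F mF tF mUF.
rewrite [X in _ --> X](_ : _ = \sum_(i <oo) config_measure (F i)).
  by apply/cvg_closeP; split; [exact: is_cvg_nneseries|rewrite closeE].
rewrite /config_measure nneseries_esumT; last by move=> i; exact: esum_ge0.
transitivity (\esum_(x in (points w : set (borel X)))
    \esum_(i in [set: nat]) (\d_x (F i) : \bar R)).
  apply: eq_esum => x _.
  by rewrite (@measure_semi_bigcup _ _ _ (dirac x))// nneseries_esumT.
rewrite !esum_esum//.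
apply/esym; rewrite (reindex_esum (points w `*`` (fun=> [set: nat]))
  _ (fun p => (p.2, p.1)))//.
by split=> [[x i] []//|[x i] [y j] _ _ [-> ->]//|[i x] [_ wx]]; exists (x, i).
Qed.

HB.instance Definition _ := isMeasure.Build _ _ _ config_measure
  config_measure0 config_measure_ge0 config_measure_sigma_additive.

End config_measure.

Record test_function := TestFunction {
  test_fun :> X -> R ;
  test_fun_continuous : continuous test_fun ;
  test_fun_compact : compact (closure [set x | test_fun x != 0]) }.

Definition vague_eval (w : config) : prod_topology (fun _ : test_function => R) :=
  fun f => \int[config_measure w]_x f x.

Definition vague := initial_topology vague_eval.

Definition Omega := g_sigma_algebraType (@open vague).

End configurations.

Section power_measure.
Context d (T : measurableType d) (R : realType) (mu : set T -> \bar R).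

(* The measure mu(dx_1) ... mu(dx_n) on T^n, built by iterating the binary
   product and transporting it along (x, t) |-> x :: t. *)
Fixpoint power_measure (n : nat) : set (n.-tuple T) -> \bar R :=
  match n with
  | 0 => dirac [tuple]
  | n.+1 => pushforward (mu \x @power_measure n)%E
              (fun p : T * n.-tuple T => [tuple of p.1 :: p.2])
  end.

End power_measure.
Arguments power_measure {d T R} mu n.

Section point_process.
Local Open Scope ereal_scope.
Context (R : realType) (X : completePseudoMetricType R).

Definition campbell_integrand (A : set (borel X)) (B : set (Omega X))
    (w : Omega X) : \bar R :=
  \int[config_measure w]_(x in A) (\1_B (config_del w x : Omega X))%:E.

Definition campbell (P : set (Omega X) -> \bar R) (A : set (borel X))
    (B : set (Omega X)) : \bar R :=
  \int[P]_w campbell_integrand A B w.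

(* [c] is the density of the Campbell measure with respect to lambda \x P.
   The Campbell measure is sigma-finite on measurable rectangles, so equality on
   rectangles determines it. The third clause says that the expectation defining
   it makes sense: the library integral is total, and does not require it. If X
   is locally compact this clause always holds; otherwise there may be too few
   compactly supported continuous functions for the vague topology to make the
   maps w |-> w(A) measurable. *)
Definition papangelou_density (lambda : set (borel X) -> \bar R)
    (P : set (Omega X) -> \bar R) (c : borel X -> Omega X -> \bar R) : Prop :=
  [/\ forall x w, 0 <= c x w,
      measurable_fun setT (fun p : borel X * Omega X => c p.1 p.2),
      forall A B, measurable A -> measurable B ->
        measurable_fun setT (campbell_integrand A B) &
      forall A B, measurable A -> measurable B ->
        campbell P A B = \int[lambda \x P]_(p in A `*` B) c p.1 p.2].

(* The inductive definition removes the last point of x_1, ..., x_n first (see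
   [compound_density_rcons]), hence the reversal of the sequence. The value is
   independent of the order of the points almost everywhere. *)
Fixpoint compound_rec (c : borel X -> Omega X -> \bar R) (s : seq X)
    (w : Omega X) : \bar R :=
  match s with
  | [::] => 1
  | y :: s' => c y w * compound_rec c s' (config_add w [:: y])
  end.

Definition compound_density c (s : seq X) (w : Omega X) : \bar R :=
  compound_rec c (rev s) w.

Lemma compound_density0 c w : compound_density c [::] w = 1.
Proof. by []. Qed.

Lemma compound_density_rcons c s y w : compound_density c (rcons s y) w =
  c y w * compound_density c s (config_add w [:: y]).
Proof. by rewrite /compound_density rev_rcons. Qed.

Definition lambda_hat (lambda : set (borel X) -> \bar R)
    (c : borel X -> Omega X -> \bar R) (n : nat) (w : Omega X)
    (A : set (n.-tuple (borel X))) : \bar R :=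
  \int[power_measure lambda n]_(x in A) compound_density c x w.

Definition eps_plus (Y : Type) (m : nat) (z : m.-tuple X) (F : Omega X -> Y) :
    Omega X -> Y :=
  fun w => F (config_add w z).

End point_process.
Arguments lambda_hat {R X} lambda c n w A.

(* Main.v *)
Require Import Defs.
From HB Require Import structures.
From mathcomp Require Import all_boot all_order all_algebra.
From mathcomp Require Import all_classical all_reals all_analysis.
From mathcomp Require Import finmap measurable_realfun lra.
Set Implicit Arguments.
Unset Strict Implicit.
Unset Printing Implicit Defensive.
Import Order.TTheory GRing.Theory Num.Theory.
Import numFieldNormedType.Exports.
Local Open Scope classical_set_scope.
Local Open Scope ring_scope.
Local Open Scope ereal_scope.

(** For a fixed configuration [w], the [n]-th power of the sum of [u] over [w^r]
    is a sum over the [n x r] arrays with entries in [w].  Sort the arrays by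
    the partition of the grid into cells with equal entries.  An array with a
    repeated entry in some row contributes 0, by the assumption on the
    diagonals; what remains is, for each non-flat partition [rho], a sum over
    the [#|rho|]-tuples of pairwise distinct points of [w]: this is
    [prod_esum_nonflat].

    The expectation of a sum over distinct points comes from iterating the
    relation that defines [c].  In functional form ([campbell_formula]) it says
    that the expectation of the sum of [f (x, w \ x)] over [x] in [w] is the
    expectation of the integral of [c x w * f (x, w)] against [lambda].  If
    [f (x, w)] is a sum of [F (x :: z) (w U x)] over tuples [z] of distinct
    points of [w], then for [x] in [w] the value [f (x, w \ x)] is the sum of
    [F (x :: z) w] over the [z] that avoid [x].  So the relation and an induction
    hypothesis applied to [c x w * F (x :: z) (w U x)] give the formula for
    tuples with one more point ([multivariate_campbell]); shifting [w] by [z]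
    inside [c x w] produces precisely the factor [c x (w U z)] by which the
    compound density grows ([compound_density_cons]).

    The measure theory rests on one fact: every point [x] of the space has a
    basic neighbourhood [V] that contains no point of [w] except possibly [x]
    ([base_isolated]).  It makes the Campbell measure finite on the rectangles
    [V x {w | w(V) <= 1}], which cover the product, so that the relation known on
    rectangles extends to all measurable functions.  It exhibits
    [w |-> sum of the Dirac masses of w] as a sum of subprobability kernels, so
    that integrals over [w] depend measurably on parameters.  And it makes
    [{(x, w) | x in w}] measurable; off this set, adding [x] to [w] shifts the
    evaluation of [w] at a test function [f] by [f x], which is continuous, and
    the measurability of [(x, w) |-> w U x] and [(x, w) |-> w \ x] follows.

    The formula for nonnegative integrands is proved with a different integrand
    in each of the [n] factors ([moment_formula_ge0]).  For signed [u] this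
    allows each factor to be split into its positive and negative parts.
    Collecting the [2^n] terms by the parity of the number of negative parts
    yields two nonnegative identities; the even and the odd terms add up to the
    positive and to the negative part of the product, and the finiteness
    assumption permits subtracting the two identities
    ([moment_formula_signed]). *)

(** * Integrals as functionals on nonnegative functions *)

Section integral_functional.
Import HBNNSimple.
Context d (T : measurableType d) (R : realType).
Implicit Types (I J : (T -> \bar R) -> \bar R) (f g : T -> \bar R).

(** Additive, positively homogeneous and continuous along increasing sequences:
    integrals, sums over sets, iterated integrals and integrals with a density
    all have this form, which is preserved by composition with functions and
    kernels. *)
Record integral_functional I : Prop := {
  ifun_ge0 : forall f, (forall x, 0 <= f x) -> 0 <= I f ;
  ifun_le : forall f g, (forall x, 0 <= f x) -> (forall x, f x <= g x) ->
    measurable_fun setT f -> measurable_fun setT g -> I f <= I g ;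
  ifun_add : forall f g, (forall x, 0 <= f x) -> (forall x, 0 <= g x) ->
    measurable_fun setT f -> measurable_fun setT g ->
    I (fun x => f x + g x) = I f + I g ;
  ifun_scale : forall (k : R) f, (0 <= k)%R -> (forall x, 0 <= f x) ->
    measurable_fun setT f -> I (fun x => k%:E * f x) = k%:E * I f ;
  ifun_cvg : forall (f_ : nat -> T -> \bar R) f,
    (forall n x, 0 <= f_ n x) -> (forall n, measurable_fun setT (f_ n)) ->
    (forall x, nondecreasing_seq (f_ ^~ x)) ->
    (forall x, f_ ^~ x @ \oo --> f x) ->
    I (f_ n) @[n --> \oo] --> I f }.

Lemma ifun0 I : integral_functional I -> I (fun=> 0) = 0.
Proof.
move=> II; have := ifun_scale II (lexx 0%R) (fun=> lexx 0) (measurable_cst 0).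
by under eq_fun do rewrite mul0e; rewrite mul0e.
Qed.

(** Every nonnegative measurable function is an increasing limit of simple
    functions. *)
Lemma integral_functional_ext I J :
  integral_functional I -> integral_functional J ->
  (forall A, measurable A ->
    I (fun x => (\1_A x)%:E) = J (fun x => (\1_A x)%:E)) ->
  forall f, (forall x, 0 <= f x) -> measurable_fun setT f -> I f = J f.
Proof.
move=> II IJ IJA f f0 mf.
have mind (A : set T) : measurable A ->
    measurable_fun setT (fun x => (\1_A x)%:E : \bar R).
  by move=> mA; apply/measurable_EFinP.
have sumE (s : seq R) (A : R -> set T) : (forall y, measurable (A y)) ->
    (forall y, y \in s -> (0 <= y)%R) ->
    [/\ forall x, 0 <= \sum_(y <- s) y%:E * (\1_(A y) x)%:E,
        measurable_fun setT (fun x => \sum_(y <- s) y%:E * (\1_(A y) x)%:E) &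
        I (fun x => \sum_(y <- s) y%:E * (\1_(A y) x)%:E) =
        J (fun x => \sum_(y <- s) y%:E * (\1_(A y) x)%:E)].
  move=> mA; elim: s => [|y s IH] s0.
    under eq_fun do rewrite big_nil.
    by split; rewrite ?ifun0// => x; rewrite big_nil.
  have y0 : (0 <= y)%R by apply: s0; rewrite mem_head.
  have [//|s_ge0 ms IJs] := IH _.
    by move=> z zs; apply: s0; rewrite in_cons zs orbT.
  have h0 x : 0 <= y%:E * (\1_(A y) x)%:E.
    by rewrite mule_ge0// lee_fin// indicE.
  have mh : measurable_fun setT (fun x => y%:E * (\1_(A y) x)%:E).
    by apply: measurable_funeM; exact: mind.
  have hE : (fun x => \sum_(z <- y :: s) z%:E * (\1_(A z) x)%:E) =
      (fun x => y%:E * (\1_(A y) x)%:E + \sum_(z <- s) z%:E * (\1_(A z) x)%:E).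
    by apply/funext => x; rewrite big_cons.
  split.
  - by move=> x; rewrite big_cons adde_ge0.
  - by rewrite hE; exact: emeasurable_funD.
  - rewrite hE (ifun_add II)// (ifun_add IJ)// IJs; congr (_ + _).
    have i0 x : 0 <= (\1_(A y) x)%:E :> \bar R by rewrite lee_fin indicE.
    have mi := mind _ (mA y).
    by rewrite (ifun_scale II)// (ifun_scale IJ)// IJA.
pose f_ := nnsfun_approx measurableT mf.
have IJf n : I (fun x => (f_ n x)%:E) = J (fun x => (f_ n x)%:E).
  have -> : (fun x => (f_ n x)%:E) =
      fun x => \sum_(y <- enum_fset (fset_set (range (f_ n))))
        y%:E * (\1_(f_ n @^-1` [set y]) x)%:E.
    apply/funext => x; rewrite {1}fimfunE -fsumEFin// fsbig_finite//.
  have [//|y|_ _ ->//] := sumE (enum_fset (fset_set (range (f_ n))))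
    (fun y => f_ n @^-1` [set y]).
  rewrite in_fset_set// => yr; have /set_mem[x _ <-] := yr; exact: fun_ge0.
have f_0 n x : 0 <= (f_ n x)%:E by rewrite lee_fin; exact: fun_ge0.
have mf_ n : measurable_fun setT (fun x => (f_ n x)%:E).
  exact/measurable_EFinP.
have ndf_ x : nondecreasing_seq (fun n => (f_ n x)%:E).
  by move=> m n mn; rewrite lee_fin; exact/lefP/nd_nnsfun_approx.
have f_f x : (f_ n x)%:E @[n --> \oo] --> f x.
  exact: (cvg_nnsfun_approx measurableT mf (fun x _ => f0 x)).
have If := ifun_cvg II f_0 mf_ ndf_ f_f.
have Jf := ifun_cvg IJ f_0 mf_ ndf_ f_f.
rewrite -(cvg_lim _ If)// -(cvg_lim _ Jf)//.
by under eq_fun do rewrite IJf.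
Qed.

Lemma integral_functional_integral (mu : {measure set T -> \bar R}) :
  integral_functional (fun f => \int[mu]_x f x).
Proof.
split=> [f f0|f g f0 fg mf mg|f g f0 g0 mf mg|k f k0 f0 mf|f_ f f_0 mf_ ndf_ f_f].
- exact: integral_ge0.
- by apply: ge0_le_integral => // x _; exact: le_trans (fg x).
- exact: ge0_integralD.
- exact: ge0_integralZl_EFin.
- have -> : \int[mu]_x f x = \int[mu]_x limn (f_ ^~ x).
    by apply: eq_integral => x _; apply/esym/cvg_lim.
  by apply: cvg_monotone_convergence => // x _; exact: ndf_.
Qed.

Lemma ifun_sum I (F : nat -> T -> \bar R) n : integral_functional I ->
  (forall i x, 0 <= F i x) -> (forall i, measurable_fun setT (F i)) ->
  I (fun x => \sum_(0 <= i < n) F i x) = \sum_(0 <= i < n) I (F i).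
Proof.
move=> II F0 mF; elim: n => [|n IH].
  by under eq_fun do rewrite big_geq//; rewrite big_geq// ifun0.
under eq_fun do rewrite big_nat_recr//=.
rewrite big_nat_recr//= (ifun_add II) ?IH// => [x|].
  exact: sume_ge0.
exact: emeasurable_sum.
Qed.

Definition functional_measure I of integral_functional I : set T -> \bar R :=
  fun A => I (fun x => (\1_A x)%:E).

Section functional_measure.
Context I (II : integral_functional I).

Let mu0 : functional_measure II set0 = 0.
Proof.
rewrite /functional_measure (_ : (fun _ => _) = fun=> 0) ?ifun0//.
by apply/funext => x; rewrite indic0.
Qed.

Let mu_ge0 A : 0 <= functional_measure II A.
Proof. by apply: (ifun_ge0 II) => x; rewrite lee_fin indicE. Qed.

Let mu_sigma_additive : semi_sigma_additive (functional_measure II).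
Proof.
move=> F mF tF mUF; rewrite /functional_measure.
have F0 i x : 0 <= (\1_(F i) x)%:E :> \bar R by rewrite lee_fin indicE.
have mFi i : measurable_fun setT (fun x => (\1_(F i) x)%:E : \bar R).
  exact/measurable_EFinP.
under eq_fun do rewrite -(ifun_sum _ II)//.
apply: (ifun_cvg II) => [n x|n|x m n mn|x].
- exact: sume_ge0.
- exact: emeasurable_sum.
- exact: lee_sum_nneg_natr.
- exact: (@measure_semi_sigma_additive _ _ _ (dirac x) F mF tF mUF).
Qed.

HB.instance Definition _ := isMeasure.Build _ _ _ (functional_measure II)
  mu0 mu_ge0 mu_sigma_additive.

(** Monotone continuity on indicators is sigma-additivity, so the functional is
    the integral of the measure that it defines. *)
Lemma integral_functional_measure f : (forall x, 0 <= f x) ->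
  measurable_fun setT f -> \int[functional_measure II]_x f x = I f.
Proof.
apply: (integral_functional_ext (integral_functional_integral _) II) => A mA.
by rewrite integral_indic// setIT.
Qed.

End functional_measure.

(** The sets [g n] make the represented measures sigma-finite, so that measures
    equal on a generating pi-system are equal. *)
Lemma integral_functional_unique I J (II : integral_functional I)
    (IJ : integral_functional J) (G : set (set T)) (g : nat -> set T) :
  measurable = <<s G >> -> setI_closed G -> (forall n, G (g n)) ->
  \bigcup_n g n = setT ->
  (forall A, G A -> I (fun x => (\1_A x)%:E) = J (fun x => (\1_A x)%:E)) ->
  (forall n, I (fun x => (\1_(g n) x)%:E) < +oo) ->
  forall f, (forall x, 0 <= f x) -> measurable_fun setT f -> I f = J f.
Proof.
move=> GE GI Gg gT IJG goo; apply: (integral_functional_ext II IJ) => A mA.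
exact: (measure_unique G g GE GI Gg gT
  (functional_measure II) (functional_measure IJ) IJG goo).
Qed.

End integral_functional.

Section integral_functional_constructions.
Context d (T : measurableType d) (R : realType).

(** The functional version of composing a measure with a kernel. *)
Lemma integral_functional_comp d' (S : measurableType d')
    (I : (S -> \bar R) -> \bar R) (K : S -> (T -> \bar R) -> \bar R) :
  integral_functional I -> (forall y, integral_functional (K y)) ->
  (forall f, (forall x, 0 <= f x) -> measurable_fun setT f ->
    measurable_fun setT (K ^~ f)) ->
  integral_functional (fun f => I (K ^~ f)).
Proof.
move=> II IK mK.
split=> [f f0|f g f0 fg mf mg|f g f0 g0 mf mg|k f k0 f0 mf|f_ f f_0 mf_ ndf_ f_f].
- by apply: (ifun_ge0 II) => y; exact: (ifun_ge0 (IK y)).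
- have g0 x : 0 <= g x by exact: le_trans (fg x).
  apply: (ifun_le II) => [y|y||]; [|exact: (ifun_le (IK y))|exact: mK..].
  exact: (ifun_ge0 (IK y)).
- rewrite -(ifun_add II) => [|y|y||]; [|exact: (ifun_ge0 (IK y))..|exact: mK|exact: mK].
  by congr I; apply/funext => y; exact: (ifun_add (IK y)).
- rewrite -(ifun_scale II) => [|//|y|]; [|exact: (ifun_ge0 (IK y))|exact: mK].
  by congr I; apply/funext => y; exact: (ifun_scale (IK y)).
- apply: (ifun_cvg II) => [n y|n|y m n mn|y].
  + exact: (ifun_ge0 (IK y)).
  + exact: mK.
  + by apply: (ifun_le (IK y)) => // x; exact: ndf_.
  + exact: (ifun_cvg (IK y)).
Qed.

Lemma integral_functional_pullback d' (S : measurableType d')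
    (I : (S -> \bar R) -> \bar R) (phi : S -> T) :
  integral_functional I -> measurable_fun setT phi ->
  integral_functional (fun f => I (fun x => f (phi x))).
Proof.
move=> II mphi.
have mc f : measurable_fun setT f ->
    measurable_fun setT (fun x => f (phi x) : \bar R).
  by move=> mf; exact: measurableT_comp.
split=> [f f0|f g f0 fg mf mg|f g f0 g0 mf mg|k f k0 f0 mf|f_ f f_0 mf_ ndf_ f_f].
- exact: (ifun_ge0 II).
- by apply: (ifun_le II) => //; exact: mc.
- by apply: (ifun_add II) => //; exact: mc.
- by apply: (ifun_scale II) => //; exact: mc.
- by apply: (ifun_cvg II) => // n; exact: mc.
Qed.

(** An infinite factor is allowed: the products are then constantly 0 if
    [l = 0], and eventually infinite otherwise. *)
Lemma ge0_cvgeMl (k : \bar R) (a : nat -> \bar R) (l : \bar R) :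
  0 <= k -> (forall n, 0 <= a n) -> nondecreasing_seq a -> a @ \oo --> l ->
  k * a n @[n --> \oo] --> k * l.
Proof.
case: k => [k _ _ _ al|_ a0 nda al|//]; first exact: cvgeMl.
have al_le n : a n <= l.
  rewrite (cvg_unique _ al (ereal_nondecreasing_cvgn nda))//.
  by apply: ereal_sup_ubound; exists n.
have [l0|l0] := eqVneq l 0.
  rewrite l0 mule0 (_ : (fun _ => _) = fun=> 0); first exact: cvg_cst.
  apply/funext => n; rewrite (_ : a n = 0) ?mule0//.
  by apply/eqP; rewrite eq_le a0 andbT -l0.
have {}l0 : 0 < l by rewrite lt_neqAle eq_sym l0 (le_trans (a0 0%N)).
rewrite gt0_mulye//; apply: cvg_near_cst.
have [n an0] : exists n, 0 < a n.
  apply: contrapT => na; have la : l <= 0.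
    rewrite (cvg_unique _ al (ereal_nondecreasing_cvgn nda))//.
    apply: ge_ereal_sup => _ [n _ <-]; rewrite leNgt; apply/negP => an0.
    by apply: na; exists n.
  by move: l0; rewrite ltNge la.
exists n => // m /= nm; rewrite gt0_mulye//.
exact: lt_le_trans an0 (nda _ _ nm).
Qed.

Lemma integral_functional_density (I : (T -> \bar R) -> \bar R) (h : T -> \bar R) :
  integral_functional I -> (forall x, 0 <= h x) -> measurable_fun setT h ->
  integral_functional (fun f => I (fun x => h x * f x)).
Proof.
move=> II h0 mh.
have mhf f : measurable_fun setT f ->
    measurable_fun setT (fun x => h x * f x).
  by move=> mf; exact: emeasurable_funM.
have hf0 f : (forall x, 0 <= f x) -> forall x, 0 <= h x * f x.
  by move=> f0 x; exact: mule_ge0.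
split=> [f f0|f g f0 fg mf mg|f g f0 g0 mf mg|k f k0 f0 mf|f_ f f_0 mf_ ndf_ f_f].
- by apply: (ifun_ge0 II); exact: hf0.
- apply: (ifun_le II); [exact: hf0| |exact: mhf..].
  by move=> x; exact: lee_wpmul2l.
- rewrite -(ifun_add II); [|exact: hf0|exact: hf0|exact: mhf|exact: mhf].
  by congr I; apply/funext => x; rewrite ge0_muleDr.
- rewrite -(ifun_scale II)//; [|exact: hf0|exact: mhf].
  by congr I; apply/funext => x; rewrite muleCA.
- apply: (ifun_cvg II) => [n|n|x m n mn|x].
  + exact: hf0.
  + exact: mhf.
  + by apply: lee_wpmul2l => //; exact: ndf_.
  + exact: ge0_cvgeMl.
Qed.

End integral_functional_constructions.

(** * Sums over sets as functionals *)

Section esum_functional.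
Context (R : realType).

(** An infinite factor is allowed: one positive term makes both sides
    infinite. *)
Lemma ge0_esumZl (T : choiceType) (S : set T) (k : \bar R) (f : T -> \bar R) :
  0 <= k -> (forall x, 0 <= f x) ->
  \esum_(x in S) (k * f x) = k * \esum_(x in S) f x.
Proof.
move=> k0 f0.
have [[x Sx fx0]|fS0] := pselect (exists2 x, S x & 0 < f x); last first.
  have f_0 x : S x -> f x = 0.
    move=> Sx; apply/eqP; rewrite eq_le f0 andbT leNgt.
    by apply/negP => fx0; apply: fS0; exists x.
  rewrite !esum1 ?mule0// => x Sx.
  by rewrite f_0// mule0.
case: k k0 => [k|_|//].
  rewrite lee_fin => k0.
  rewrite /esum -ereal_supZl//; last first.
    by apply/set0P; exists 0, set0; [exact: fsets_set0|rewrite fsbig_set0].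
  rewrite image_comp; congr ereal_sup; apply: eq_imagel => A _ /=.
  by rewrite ge0_mule_fsumr.
have leS (g : T -> \bar R) : (forall y, 0 <= g y) -> g x <= \esum_(y in S) g y.
  move=> g0; apply: esum_ge; exists [set x]; last by rewrite fsbig_set1.
  by split=> // _ ->.
have kf0 y : 0 <= +oo * f y by rewrite mule_ge0.
rewrite gt0_mulye; last exact: lt_le_trans (leS f f0).
by apply/eqP; rewrite -leye_eq; apply: le_trans (leS _ kf0); rewrite gt0_mulye.
Qed.

Lemma integral_functional_esum d (T : measurableType d) (S : set T) :
  integral_functional (fun f : T -> \bar R => \esum_(x in S) f x).
Proof.
split=> [f f0|f g f0 fg mf mg|f g f0 g0 mf mg|k f k0 f0 mf|f_ f f_0 mf_ ndf_ f_f].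
- exact: esum_ge0.
- exact: le_esum.
- by rewrite esumD.
- exact: ge0_esumZl.
- have nd_esum : nondecreasing_seq (fun n => \esum_(x in S) f_ n x).
    by move=> m n mn; apply: le_esum => x _; exact: ndf_.
  have f_le n x : f_ n x <= f x.
    rewrite (cvg_unique _ (f_f x) (ereal_nondecreasing_cvgn (ndf_ x)))//.
    by apply: ereal_sup_ubound; exists n.
  suff <- : ereal_sup (range (fun n => \esum_(x in S) f_ n x)) =
      \esum_(x in S) f x by exact: ereal_nondecreasing_cvgn.
  apply/eqP; rewrite eq_le; apply/andP; split.
    by apply: ge_ereal_sup => _ [n _ <-]; exact: le_esum.
  apply: ge_ereal_sup => _ [A [finA AS] <-].
  have cA : \sum_(x \in A) f_ n x @[n --> \oo] --> \sum_(x \in A) f x.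
    rewrite fsbig_finite//; under eq_fun do rewrite fsbig_finite//.
    by apply: cvg_nnesum => // x _; exact: nearW.
  rewrite -(cvg_lim _ cA)//; apply: lime_le; first by apply/cvg_ex; eexists; exact: cA.
  apply: nearW => n; apply: le_trans (ereal_sup_ubound _); last by exists n.
  by apply: esum_ge; exists A.
Qed.

End esum_functional.

(** * Countable bases and locally finite sets *)

Section base.
Context (R : realType) (X : completePseudoMetricType R).

Definition is_base (U : nat -> set X) :=
  (forall n, open (U n)) /\
  (forall x A, nbhs x A -> exists n, U n x /\ U n `<=` A).

(** Interiors of the balls of radius [1/k] around a countable dense set; each is
    found from an injective code of its centre and its index. *)
Lemma separable_base : separable_space X -> exists U, is_base U.
Proof.
move=> [D /countable_injP[h hinj] dD].
pose V y k : set X := (ball y k.+1%:R^-1)°.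
pose code (y : X) (k : nat) : nat := choice.pickle (h y, k).
pose U n : set X :=
  \bigcup_(p in [set p : X * nat | D p.1 /\ code p.1 p.2 = n]) V p.1 p.2.
exists U; split=> [n|x A /nbhs_ballP[_/posnumP[e] xeA]].
  by apply: bigcup_open => p _; exact: open_interior.
have [//|k] := @ltr_add_invr R 0%R (e%:num/2) _; rewrite add0r => ke.
have k0 : (0 < k.+1%:R^-1 / 2 :> R)%R by rewrite divr_gt0.
have := dD (ball x (k.+1%:R^-1 / 2))°%classic.
have Vx0 : (ball x (k.+1%:R^-1 / 2))° !=set0.
  by exists x; exact: nbhsx_ballx.
move=> /(_ Vx0 (open_interior _))[y [/interior_subset Vy Dy]].
have Vyx : V y k x.
  apply: filterS (nbhsx_ballx x _ k0) => z xz.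
  by rewrite [k.+1%:R^-1%R]splitr; apply: ball_triangle xz; exact: ball_sym.
exists (code y k); split; first by exists (y, k).
move=> z [[y' k'] /= [Dy' cE] Vz].
have [E1 E2] := pcan_inj choice.pickleK cE.
have {}E1 : y' = y by apply: hinj => //; exact: mem_set.
rewrite E1 E2 in Vz; apply: xeA.
rewrite [e%:num%R]splitr; apply: (@ball_triangle _ _ y).
  apply: le_ball Vy; apply: ltW; apply: le_lt_trans ke.
  by rewrite ler_pdivrMr// ler_peMr// ler1n.
by apply: le_ball (interior_subset Vz); exact: ltW.
Qed.

(** A filter that does not cluster at [x] avoids a neighbourhood of [x], hence
    contains a finite set of terms. *)
Lemma compact_range_cvg (a : nat -> X) (x : X) :
  a @ \oo --> x -> compact (x |` range a).
Proof.
move=> ax F PF FK.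
have [Fx|] := pselect (cluster F x); first by exists x; split=> //; left.
rewrite /cluster/= => /existsNP[G] /existsNP[N] /not_implyP[FG]
  /not_implyP[xN] GN0.
have [n _ nN] := ax _ xN.
have finK : finite_set (a @` `I_n) by exact/finite_image/finite_II.
have FKn : F (a @` `I_n).
  apply: filterS (filterI FG FK) => y [Gy [yx|[m _ amy]]].
    by exfalso; apply: GN0; exists y; split=> //; rewrite yx; exact: nbhs_singleton.
  have [mn|nm] := ltnP m n; first by exists m.
  exfalso; apply: GN0; exists y; split=> //; rewrite -amy; exact: nN.
have cK := finite_compact finK.
have [y [[m mn <-] Fy]] := cK F PF FKn.
by exists (a m); split=> //; right; exists m.
Qed.

Hypothesis hausdorffX : hausdorff_space X.

(** Finiteness is known on compact sets only.  If [x] were a limit of points of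
    [w] other than [x], such points and [x] would form a compact set, so there
    would be finitely many of them, at positive distance from [x]. *)
Lemma locally_finite_isolated (w : set X) (x : X) : locally_finite w ->
  exists2 A, nbhs x A & A `&` w `<=` [set x].
Proof.
move=> lfw; apply: contrapT => nA.
have hex n : exists y, [/\ ball x n.+1%:R^-1 y, w y & y <> x].
  apply: contrapT => nex; apply: nA; exists (ball x n.+1%:R^-1).
    exact: nbhsx_ballx.
  by move=> y [xy wy]; apply: contrapT => yx; apply: nex; exists y.
pose a n := projT1 (cid (hex n)).
have aP n : [/\ ball x n.+1%:R^-1 (a n), w (a n) & a n <> x].
  exact: projT2 (cid (hex n)).
have ax : a @ \oo --> x.
  move=> A /nbhs_ballP[_/posnumP[e] xeA].
  have [//|k] := @ltr_add_invr R 0%R e%:num _; rewrite add0r => ke.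
  exists k => // n /= kn; apply: xeA; have [+ _ _] := aP n.
  apply: le_ball; apply: le_trans (ltW ke).
  by rewrite lef_pV2 ?posrE// ler_nat.
have /lfw : compact (x |` range a) by exact: compact_range_cvg.
have ra : range a `<=` (x |` range a) `&` w.
  by move=> y [n _ <-]; split; [right; exists n|have [] := aP n].
move=> /(sub_finite_set ra) fra.
have /ax[n _ /(_ n (leqnn n)) /= ] : nbhs x (~` range a).
  apply: open_nbhs_nbhs; split.
    apply: closed_openC; apply: compact_closed => //; exact: finite_compact.
  by move=> [n _]; have [] := aP n.
by apply; exists n.
Qed.

End base.

(** * The measure of a configuration *)

Section sigma_finite_copy.
Context d (T : measurableType d) (R : realType) (mu : {measure set T -> \bar R}).

(** The proof of sigma-finiteness is an argument of the copy, from which the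
    structure of sigma-finite measure can be inferred. *)
Definition sigma_finite_copy of sigma_finite setT mu : set T -> \bar R := mu.

Hypothesis sf : sigma_finite setT mu.

HB.instance Definition _ := Measure.on (sigma_finite_copy sf).
HB.instance Definition _ :=
  Measure_isSigmaFinite.Build _ _ _ (sigma_finite_copy sf) sf.

End sigma_finite_copy.

Section config_measure_theory.
Context (R : realType) (X : completePseudoMetricType R).
Implicit Types (w : config X) (A : set (borel X)).

Lemma config_eq w w' : points w = points w' -> w = w'.
Proof.
by case: w w' => [p lp] [p' lp'] /= E; move: lp lp'; rewrite E => *;
  congr Config; exact: Prop_irrelevance.
Qed.

Lemma open_borel (A : set X) : open A -> measurable (A : set (borel X)).
Proof. exact: sub_sigma_algebra. Qed.

Lemma integral_config w (f : borel X -> \bar R) :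
  (forall x, 0 <= f x) -> measurable_fun setT f ->
  \int[config_measure w]_x f x = \esum_(x in (points w : set (borel X))) f x.
Proof.
apply: (integral_functional_ext (integral_functional_integral _)
  (integral_functional_esum _ _)) => A mA.
rewrite integral_indic// setIT /config_measure; apply: eq_esum => x _.
by rewrite diracE indicE.
Qed.

Lemma config_measure_le1 w A x : A `&` points w `<=` [set x] ->
  config_measure w A <= 1.
Proof.
move=> Ax; rewrite /config_measure.
apply: ge_ereal_sup => _ [B [finB Bw] <-].
apply: (@le_trans _ _ (\sum_(y \in B) if y == x then 1 else 0)).
  apply: lee_fsum => // y By; rewrite diracE.
  have [yA|yA] := boolP (y \in A); last by case: ifP.
  by rewrite (Ax y) ?eqxx//; split; [exact: set_mem|exact: Bw].
have [xB|xB] := pselect (B x).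
  rewrite (fsbigD1 x)//= eqxx fsbig1 ?adde0// => y [_ /eqP/negbTE] -> //.
by rewrite fsbig1// => y By; case: eqP => // yx; case: xB; rewrite -yx.
Qed.

Lemma config_measure_ge1 w A x : points w x -> A x -> 1 <= config_measure w A.
Proof.
move=> wx Ax; rewrite /config_measure; apply: esum_ge; exists [set x].
  by split=> // _ ->.
by rewrite fsbig_set1 diracE mem_set.
Qed.

Lemma config_measure0P w A : config_measure w A = 0 <-> A `&` points w = set0.
Proof.
split=> [wA0|Aw0].
  rewrite -subset0 => x [Ax wx].
  by have := config_measure_ge1 wx Ax; rewrite wA0 lee_fin ler10.
rewrite /config_measure esum1// => x wx; rewrite diracE memNset// => Ax.
by have : (A `&` points w) x by []; rewrite Aw0.
Qed.

Hypothesis hausdorffX : hausdorff_space X.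
Context (U : nat -> set X) (baseU : is_base U).

Lemma base_isolated w (x : X) :
  exists n, U n x /\ U n `&` points w `<=` [set x].
Proof.
have [A xA Aw] := locally_finite_isolated hausdorffX x (points_lf w).
have [n [Unx UnA]] := baseU.2 _ _ xA.
by exists n; split=> // y [/UnA Ay wy]; exact: Aw.
Qed.

Lemma base_borel n : measurable (U n : set (borel X)).
Proof. exact: open_borel (baseU.1 n). Qed.

Lemma config_sigma_finite w : sigma_finite setT (config_measure w).
Proof.
exists (fun n => if `[< config_measure w (U n) <= 1 >] then U n else set0).
  apply/esym; rewrite -subTset => x _.
  have [n [Unx /config_measure_le1 wUn]] := base_isolated w x.
  by exists n => //; rewrite asboolT.
move=> n; case: asboolP => [wUn|_].
  split; first exact: base_borel.
  by apply: le_lt_trans wUn _; exact: ltry.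
by split=> //; rewrite measure0.
Qed.

Lemma config_sigma_finite_measure w :
  exists m : {sigma_finite_measure set (borel X) -> \bar R},
    m = config_measure w :> (set (borel X) -> \bar R).
Proof. by exists (sigma_finite_copy (config_sigma_finite w)). Qed.

Lemma measurable_diag :
  measurable [set p : borel X * borel X | p.1 = p.2].
Proof.
rewrite -[X in measurable X]setCK; apply: measurableC.
rewrite [X in measurable X](_ : _ = \bigcup_n \bigcup_k
    if `[< U n `&` U k = set0 >] then U n `*` U k else set0); last first.
  apply/seteqP; split=> [[x y] /= /eqP xy|[x y] [n _ [k _]]].
    move: hausdorffX; rewrite open_hausdorff => /(_ _ _ xy).
    move=> [[A B]/= [/set_mem xA /set_mem yB] [oA oB /eqP AB]].
    have [n [Unx UnA]] := baseU.2 x A (open_nbhs_nbhs (conj oA xA)).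
    have [k [Uky UkB]] := baseU.2 y B (open_nbhs_nbhs (conj oB yB)).
    exists n => //; exists k => //; rewrite asboolT//.
    by rewrite -subset0 -AB; exact: setISS.
  case: asboolP => // nk0 [/= Unx Uky] xy.
  have : (U n `&` U k) x by split=> //; rewrite xy.
  by rewrite nk0.
apply: bigcupT_measurable => n; apply: bigcupT_measurable => k.
by case: asboolP => // _; apply: measurableX; exact: base_borel.
Qed.

End config_measure_theory.

(** * Measurability of adding and deleting a point *)

Section vague_measurability.
Context (R : realType) (X : completePseudoMetricType R).
Implicit Types (w : config X).

Lemma points_add1 w x : points (config_add w [:: x]) = x |` points w.
Proof.
apply/seteqP; split=> y /=; rewrite mem_seq1.
  by move=> [wy|/eqP ->]; [right|left].
by move=> [->|wy]; [right|left].
Qed.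

Lemma test_fun_measurable (f : test_function X) :
  measurable_fun setT (f : borel X -> R).
Proof.
apply: (measurability _ (RGenOpens.measurableE R)) => _ [_ [a [b ->] <-]].
rewrite setTI; apply: open_borel.
exact: open_comp (fun x _ => test_fun_continuous (x := x)) (interval_open _ _).
Qed.

(** A test function sees finitely many points of a configuration. *)
Lemma integral_test_fun_lty w (f : test_function X) (g : borel X -> \bar R) :
  (forall x, 0 <= g x) -> (forall x, g x < +oo) -> measurable_fun setT g ->
  (forall x, f x = 0%R -> g x = 0) ->
  \int[config_measure w]_x g x < +oo.
Proof.
move=> g0 goo mg fg; rewrite integral_config//.
pose K := closure [set x | f x != 0%R].
have finK : finite_set (K `&` points w).
  exact: (points_lf w (test_fun_compact (t := f))).
rewrite (esumID (K : set (borel X)))//.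
rewrite [X in _ + X]esum1 ?adde0; last first.
  move=> x [_ Kx]; apply: fg; apply: contrapT => /eqP fx0; apply: Kx.
  exact: subset_closure.
rewrite setIC in finK.
rewrite esum_fset// fsbig_finite//.
by apply: lte_sum_pinfty => x _; exact: goo.
Qed.

(** Evaluation is a difference of two integrals, both finite, and each of them
    grows by one term. *)
Lemma vague_eval_insert w w' (x : X) (f : test_function X) :
  ~ points w x -> points w' = x |` points w ->
  vague_eval w' f = (vague_eval w f + f x)%R.
Proof.
move=> wx w'E.
have insE (g : borel X -> \bar R) : (forall y, 0 <= g y) ->
    measurable_fun setT g ->
    \int[config_measure w']_y g y = \int[config_measure w]_y g y + g x.
  move=> g0 mg; rewrite !integral_config// w'E.
  rewrite (esumID ([set x] : set (borel X)))// addeC; congr (_ + _).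
    congr esum; apply/seteqP; split=> [y [[yx|//] nyx]|y wy].
      by case: nyx.
    by split; [right|move=> yx; apply: wx; rewrite -yx].
  by rewrite setUK esum_set1.
have mf : measurable_fun setT (fun y : borel X => (f y)%:E).
  by apply/measurable_EFinP; exact: (test_fun_measurable f).
have mfp : measurable_fun setT (fun y : borel X => (f y)%:E)^\+.
  exact: measurable_funepos.
have mfn : measurable_fun setT (fun y : borel X => (f y)%:E)^\-.
  exact: measurable_funeneg.
rewrite /vague_eval /Rintegral (integralE (config_measure w')).
rewrite (integralE (config_measure w)) !insE//.
set a := \int[config_measure w]_y (fun y : borel X => (f y)%:E)^\+ y.
set b := \int[config_measure w]_y (fun y : borel X => (f y)%:E)^\- y.
have afin : a \is a fin_num.
  rewrite ge0_fin_numE; last exact: integral_ge0.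
  apply: (@integral_test_fun_lty _ f) => // y.
    by rewrite funeposE -EFin_max ltry.
  by move=> fy0; rewrite funeposE fy0 maxxx.
have bfin : b \is a fin_num.
  rewrite ge0_fin_numE; last exact: integral_ge0.
  apply: (@integral_test_fun_lty _ f) => // y.
    by rewrite funenegE -EFinN -EFin_max ltry.
  by move=> fy0; rewrite funenegE fy0 oppe0 maxxx.
have -> : f x = fine ((fun y : borel X => (f y)%:E)^\+ x -
    (fun y : borel X => (f y)%:E)^\- x).
  by rewrite -(congr1 (fun g => g x) (funeposneg (fun y : borel X => (f y)%:E))).
have pfin : (fun y : borel X => (f y)%:E)^\+ x \is a fin_num.
  by rewrite funeposE -EFin_max.
have nfin : (fun y : borel X => (f y)%:E)^\- x \is a fin_num.
  by rewrite funenegE -EFinN -EFin_max.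
clearbody a b; move: pfin nfin.
set p := (fun y : borel X => (f y)%:E)^\+ x.
set q := (fun y : borel X => (f y)%:E)^\- x.
clearbody p q.
case: a b p q afin bfin => [a||] [b||] [p||] [q||]//= _ _ _ _.
by rewrite opprD addrACA.
Qed.

Hypothesis hausdorffX : hausdorff_space X.
Context (U : nat -> set X) (baseU : is_base U).

(** Second countability of [X] suffices: an open set of the product is the union
    over [n] of [U n] times the largest vaguely open set that fits, a countable
    union of rectangles even when the vague topology has no countable base. *)
Lemma measurable_continuous_preimage (T : topologicalType)
    (h : X * vague X -> T) (O : set T) : continuous h -> open O ->
  measurable (h @^-1` O : set (borel X * Omega X)).
Proof.
move=> ch oO.
pose V n : set (vague X) := \bigcup_(B in [set B | open B /\
  U n `*` B `<=` h @^-1` O]) B.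
rewrite [X in measurable X](_ : _ = \bigcup_n (U n `*` V n)); last first.
  apply/seteqP; split=> [[x w] Oh|[x w] [n _ [/= Unx [B [_ UB] Bw]]]]; last first.
    exact: UB.
  have /= [[A B] [/= xA wB] AB] := ch (x, w) _ (open_nbhs_nbhs (conj oO Oh)).
  have [n [Unx UnA]] := baseU.2 _ _ xA.
  exists n => //; split=> //=; exists B°; last first.
    exact: wB.
  split; first exact: open_interior.
  by move=> [y v] [/= /UnA Ay /interior_subset Bv]; exact: AB.
apply: bigcupT_measurable => n; apply: measurableX; first exact: base_borel.
apply: sub_sigma_algebra; apply: bigcup_open => B [] //.
Qed.

Lemma continuous_vague_eval (f : test_function X) :
  continuous (fun w : vague X => vague_eval w f).
Proof.
move=> w; pose E : vague X -> prod_topology (fun _ : test_function X => R) :=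
  @vague_eval R X.
have /cvg_sup/(_ f) cE : E @ w --> E w by exact: initial_continuous.
move=> A /=; rewrite nbhsE => -[C [oC Cw] CA].
suff : (E @ w) ((fun g => g f) @^-1` A) by [].
have FE : Filter (E @ w) by apply: fmap_filter; apply: nbhs_filter.
apply: (cE FE); rewrite nbhsE; exists ((fun g => g f) @^-1` C); last by move=> g /CA.
by split=> //; exists C.
Qed.

Lemma continuous_eval_shift (s : R) : continuous
  (fun p : X * vague X =>
    (fun f : test_function X => vague_eval p.2 f + s * f p.1)%R :
      prod_topology (fun _ : test_function X => R)).
Proof.
move=> p; apply/cvg_sup => f A; rewrite nbhsE => -[B [[C oC <-] Cp] CA].
have cf : {for p, continuous (fun q : X * vague X =>
    vague_eval q.2 f + s * f q.1)%R}.
  have c1 : (fun q : X * vague X => vague_eval q.2 f) q @[q --> p] -->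
      vague_eval p.2 f.
    exact: (cvg_comp _ _ (@cvg_snd _ _ (nbhs p.1) (nbhs p.2) _) (@continuous_vague_eval f p.2)).
  have c2 : (fun q : X * vague X => f q.1) q @[q --> p] --> f p.1.
    exact: (cvg_comp _ _ (@cvg_fst _ _ (nbhs p.1) (nbhs p.2) _) (@test_fun_continuous _ _ f p.1)).
  exact: (cvgD c1 (cvgMl_tmp c2)).
have /= cC := cf C (open_nbhs_nbhs (conj oC Cp)).
have Fp : Filter (nbhs p) by apply: nbhs_filter.
by apply: (@filterS _ (nbhs p) Fp _ _ _ cC) => q Cq; apply: CA.
Qed.

Hypothesis mass_measurable : forall A : set (borel X), measurable A ->
  measurable_fun setT (fun w : Omega X => config_measure w A).

(** [x] lies outside [w] exactly when some basic neighbourhood of [x] has no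
    mass. *)
Lemma measurable_config_mem :
  measurable [set p : borel X * Omega X | points p.2 p.1].
Proof.
rewrite -[X in measurable X]setCK; apply: measurableC.
rewrite [X in measurable X](_ : _ = \bigcup_n
    (U n `*` [set w | config_measure w (U n) = 0])); last first.
  apply/seteqP; split=> [[x w] /= wx|[x w] [n _ [/= Unx]]]; last first.
    move=> /config_measure0P Unw wx.
    by have : (U n `&` points w) x by []; rewrite Unw.
  have [n [Unx Unw]] := base_isolated hausdorffX baseU w x.
  exists n => //; split=> //=; apply/config_measure0P.
  by rewrite -subset0 => y [Uny wy]; apply: wx; rewrite -(Unw y).
apply: bigcupT_measurable => n; apply: measurableX.
  exact: (base_borel baseU).
rewrite -[X in measurable X]setTI.
exact: (mass_measurable (base_borel baseU n) measurableT (emeasurable_set1 0)).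
Qed.

Let M : set (borel X * Omega X) := [set p | points p.2 p.1].

(** Adding and deleting [x] both leave [w] alone on a measurable set [D] and
    shift every evaluation by [s * f x] off [D], with [s = 1] or [s = -1].  The
    shift is continuous, whereas [w U x] jumps when [x] reaches a point of
    [w]. *)
Lemma measurable_piecewise_eval (s : R) (h : borel X * Omega X -> Omega X)
    (D : set (borel X * Omega X)) : measurable D ->
  (forall p, D p -> h p = p.2) ->
  (forall p f, ~ D p -> vague_eval (h p) f = vague_eval p.2 f + s * f p.1)%R ->
  measurable_fun setT h.
Proof.
move=> mD hD hnD.
apply: (@measurability _ _ _ (Omega X) setT h (@open (vague X)) erefl).
move=> _ [_ [A oA <-] <-].
rewrite setTI.
rewrite [X in measurable X](_ : _ = (D `&` (setT `*` (@vague_eval R X @^-1` A)))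
    `|` (~` D `&` (fun p : X * vague X =>
    (fun f : test_function X => vague_eval p.2 f + s * f p.1)%R :
      prod_topology (fun _ : test_function X => R)) @^-1` A)); last first.
  apply/seteqP; split=> [[x w] Ahp|[x w]].
    have [Dp|Dp] := pselect (D (x, w)).
      by left; split=> //; split=> //=; move: Ahp; rewrite /preimage/= hD.
    right; split=> //; move: Ahp; rewrite /preimage/=; congr A.
    by apply/funext => f; rewrite hnD.
  move=> [[Dp [_ Aw]]|[Dp Aw]].
    by rewrite /preimage/= hD.
  move: Aw; rewrite /preimage/=; congr A.
  by apply/funext => f; rewrite hnD.
apply: measurableU; apply: measurableI => //.
- apply: measurableX => //; apply: sub_sigma_algebra; exists A => //.
- exact: measurableC.
- by apply: measurable_continuous_preimage => //; exact: continuous_eval_shift.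
Qed.

Lemma measurable_config_add1 :
  measurable_fun setT (fun p : borel X * Omega X => config_add p.2 [:: p.1] : Omega X).
Proof.
apply: (@measurable_piecewise_eval 1 _ M); first exact: measurable_config_mem.
- by move=> [x w] /= wx; apply: config_eq; rewrite points_add1 setUidr// => _ ->.
- move=> [x w] f /= wx; rewrite mul1r; apply: vague_eval_insert => //.
  exact: points_add1.
Qed.

Lemma measurable_config_del :
  measurable_fun setT (fun p : borel X * Omega X => config_del p.2 p.1 : Omega X).
Proof.
apply: (@measurable_piecewise_eval (-1) _ (~` M)).
- by apply: measurableC; exact: measurable_config_mem.
- move=> [x w] /= wx; apply: config_eq => /=; exact: not_setD1.
- move=> [x w] f /= /contrapT wx; rewrite mulN1r; apply/eqP.
  rewrite -subr_eq opprK; apply/eqP/esym; apply: vague_eval_insert => /=.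
    by move=> [_]; apply.
  by rewrite setD1K.
Qed.

End vague_measurability.

(** * Configurations as an s-finite kernel *)

Section config_kernel.
Context (R : realType) (X : completePseudoMetricType R).
Hypothesis hausdorffX : hausdorff_space X.
Context (U : nat -> set X) (baseU : is_base U).
Hypothesis mass_measurable : forall A : set (borel X), measurable A ->
  measurable_fun setT (fun w : Omega X => config_measure w A).

(** The light basic sets cover [X], whatever the configuration. *)
Definition light n (w : config X) : bool := config_measure w (U n) <= 1.

(** [A] without the first [n] light sets.  The recursion makes its mass a nested
    case distinction on finitely many measurable conditions. *)
Fixpoint light_diff (A : set (borel X)) n (w : config X) : set (borel X) :=
  match n with
  | 0 => A
  | n.+1 => light_diff (if light n w then A `\` U n else A) n w
  end.

Lemma light_diffP A n w x : light_diff A n w x <->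
  A x /\ forall k, (k < n)%N -> light k w -> ~ U k x.
Proof.
elim: n A => [|n IH] A /=; first by split=> [//|[]].
rewrite IH; split=> [[Ax kn]|[Ax kn]].
  split; first by move: Ax; case: ifP => // _ [].
  move=> k; rewrite ltnS leq_eqVlt => /predU1P[->|]; last exact: kn.
  by move: Ax; case: ifP => // _ [].
split; last by move=> k kn'; apply: kn; exact: ltnW.
by case: ifPn => // ln; split=> //; exact: (kn n).
Qed.

Lemma measurable_light n : measurable_fun setT (light n : Omega X -> bool).
Proof.
apply: measurable_fun_lee; last exact: measurable_cst.
exact: mass_measurable (base_borel baseU n).
Qed.

Lemma measurable_light_diff A n w : measurable A -> measurable (light_diff A n w).
Proof.
elim: n A => [//|n IH] A mA /=; apply: IH; case: ifP => // _.
by apply: measurableD => //; exact: (base_borel baseU).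
Qed.

Lemma measurable_mass_light_diff A n : measurable A ->
  measurable_fun setT (fun w : Omega X => config_measure w (light_diff A n w)).
Proof.
elim: n A => [|n IH] A mA /=; first exact: mass_measurable.
rewrite (_ : (fun _ => _) = fun w : Omega X => if light n w
    then config_measure w (light_diff (A `\` U n) n w)
    else config_measure w (light_diff A n w)); last first.
  by apply/funext => w; case: ifP.
apply: measurable_fun_ifT; first exact: measurable_light.
  by apply: IH; apply: measurableD => //; exact: (base_borel baseU).
exact: IH.
Qed.

(** The pieces partition [X] in a way that depends on [w], and each has mass at
    most 1. *)
Definition piece n w : set (borel X) :=
  light_diff (if light n w then U n else set0) n w.

Lemma measurable_piece n w : measurable (piece n w).
Proof.
by apply: measurable_light_diff; case: ifP => // _; exact: (base_borel baseU).
Qed.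

Lemma trivIset_piece w : trivIset setT (piece ^~ w).
Proof.
apply: ltn_trivIset => m n mn; rewrite -subset0 => x.
move=> [/light_diffP[xn nx]] /light_diffP[xm mx].
by move: xn mx; case: ifP => // ln Un /(_ _ mn ln).
Qed.

(** [x] belongs to the piece of the first light set that contains it. *)
Lemma bigcup_piece w : \bigcup_n piece n w = setT.
Proof.
rewrite -subTset => x _.
have [n [Unx Uw]] := base_isolated hausdorffX baseU w x.
have ex : exists n, light n w && `[< U n x >].
  by exists n; rewrite /light (config_measure_le1 Uw); exact/asboolP.
case: (ex_minnP ex) => m /andP[lm /asboolP Um] minm.
exists m => //; apply/light_diffP; split; first by rewrite lm.
move=> k km lk Uk; have := minm k; rewrite lk asboolT//= => /(_ isT).
by rewrite leqNgt km.
Qed.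

Lemma piece_le1 n w : config_measure w (piece n w) <= 1.
Proof.
rewrite /piece; case: ifPn => ln; last first.
  rewrite (_ : light_diff _ _ _ = set0) ?measure0//.
  by rewrite -subset0 => x /light_diffP[].
apply: le_trans ln; apply: le_measure.
- by apply: mem_set; apply: measurable_light_diff; exact: (base_borel baseU n).
- by apply: mem_set; exact: (base_borel baseU n).
- by move=> x /light_diffP[].
Qed.

Section kernel.
Context d (Y : measurableType d) (g : Y -> Omega X).
Hypothesis mg : measurable_fun setT g.

Definition config_kernel (y : Y) : {measure set (borel X) -> \bar R} :=
  config_measure (g y).

Let config_kernel_measurable A : measurable A ->
  measurable_fun setT (config_kernel ^~ A).
Proof. by move=> mA; exact: (measurableT_comp (mass_measurable mA) mg). Qed.

HB.instance Definition _ :=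
  isKernel.Build _ _ _ _ R config_kernel config_kernel_measurable.

Definition piece_kernel n (y : Y) : {measure set (borel X) -> \bar R} :=
  mrestr (config_measure (g y)) (measurable_piece n (g y)).

Let piece_kernel_measurable n A : measurable A ->
  measurable_fun setT (piece_kernel n ^~ A).
Proof.
move=> mA; rewrite /piece_kernel/= /mrestr.
apply: (@measurableT_comp _ _ _ _ _ _ (fun w : Omega X =>
  config_measure w (A `&` piece n w))) => //.
rewrite (_ : (fun _ => _) = fun w : Omega X => if light n w
    then config_measure w (light_diff (A `&` U n) n w) else 0); last first.
  apply/funext => w; rewrite /piece; case: ifP => ln.
    congr (config_measure w); apply/seteqP; split=> x.
      by move=> [Ax /light_diffP[Ux kn]]; apply/light_diffP.
    by move=> /light_diffP[[Ax Ux] kn]; split=> //; apply/light_diffP.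
  apply/config_measure0P; rewrite -subset0 => x [[_ /light_diffP[//]]].
apply: measurable_fun_ifT; [exact: measurable_light| |exact: measurable_cst].
by apply: measurable_mass_light_diff; apply: measurableI => //; exact: (base_borel baseU).
Qed.

HB.instance Definition _ n := isKernel.Build _ _ _ _ R
  (piece_kernel n) (@piece_kernel_measurable n).

Let piece_kernel_uub n : measure_fam_uub (piece_kernel n).
Proof.
exists 2%R => y; rewrite /piece_kernel /= /mrestr setTI.
by apply: le_lt_trans (piece_le1 n (g y)) _; rewrite lte_fin ltr1n.
Qed.

HB.instance Definition _ n := @Kernel_isFinite.Build _ _ _ _ R
  (piece_kernel n) (@piece_kernel_uub n).

Let config_kernel_sfinite : exists s : (R.-fker Y ~> (borel X))^nat,
  forall y A, measurable A -> config_kernel y A = kseries s y A.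
Proof.
exists (fun n => piece_kernel n) => y A mA.
rewrite /kseries/= /mseries/= /config_kernel.
rewrite -[in LHS](setIT A) -(bigcup_piece (g y)) setI_bigcupr.
have mAp n : measurable (A `&` piece n (g y)).
  by apply: measurableI => //; exact: measurable_piece.
rewrite measure_semi_bigcup//; last exact: bigcupT_measurable.
by apply: trivIset_setIl; exact: trivIset_piece.
Qed.

HB.instance Definition _ :=
  @Kernel_isSFinite.Build _ _ _ _ R config_kernel config_kernel_sfinite.

(** The restrictions of [w] to its pieces are subprobability kernels that add up
    to [w]. *)
Lemma measurable_integral_config (f : Y * borel X -> \bar R) :
  (forall p, 0 <= f p) -> measurable_fun setT f ->
  measurable_fun setT (fun y => \int[config_measure (g y)]_x f (y, x)).
Proof.
move=> f0 mf.
exact: (@measurable_fun_integral_sfinite_kernel _ _ _ _ R f config_kernel f0 mf).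
Qed.

End kernel.

End config_kernel.

(** * Iterated product measures *)

Lemma eq_integralT d (T : measurableType d) (R : realType) (mu : set T -> \bar R)
    (f g : T -> \bar R) :
  (forall x, f x = g x) -> \int[mu]_x f x = \int[mu]_x g x.
Proof. by move=> /funext ->. Qed.

Section power_measure_theory.
Context d (T : measurableType d) (R : realType).
Lemma integral_power0 (mu : set T -> \bar R) (f : 0.-tuple T -> \bar R) :
  measurable_fun setT f -> \int[power_measure mu 0]_t f t = f [tuple].
Proof. by move=> mf; rewrite /= integral_dirac// diracT mul1e. Qed.

Variable mu : {sigma_finite_measure set T -> \bar R}.

Lemma measurable_cons_tuple d' (Y : measurableType d') n (f : Y -> T)
    (g : Y -> n.-tuple T) : measurable_fun setT f -> measurable_fun setT g ->
  measurable_fun setT (fun y => [tuple of f y :: g y]).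
Proof. exact: measurable_cons. Qed.

(** The recursion defines a set function only; the structure of sigma-finite
    measure is rebuilt at every step. *)
Lemma power_measure_sigma_finite n :
  exists m : {sigma_finite_measure set (n.-tuple T) -> \bar R},
    power_measure mu n = m.
Proof.
elim: n => [|n [m IH]]; first by exists (dirac [tuple]).
pose C (p : T * n.-tuple T) := [tuple of p.1 :: p.2].
have mC : measurable_fun setT C by exact: measurable_cons_tuple.
pose pm : {measure set (n.+1.-tuple T) -> \bar R} :=
  [the measure _ _ of pushforward (mu \x m) C].
have [F FT FP] : sigma_finite setT (mu \x m).
  have /sigma_finiteP[F [TF ndF Foo]] := sigma_finiteT mu.
  have /sigma_finiteP[G [TG ndG Goo]] := sigma_finiteT m.
  exists (fun k => F k `*` G k).
    rewrite -setXTT TF TG; apply/seteqP; split=> [[x y] [[i _ Fx] [k _ Gy]]|].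
      exists (maxn i k) => //; split.
        exact: ((subsetPset _ _ (ndF _ _ (leq_maxl i k))) x Fx).
      exact: ((subsetPset _ _ (ndG _ _ (leq_maxr i k))) y Gy).
    by move=> [x y] [k _ [Fx Gy]]; split; exists k.
  move=> k; have [mF oF] := Foo k; have [mG oG] := Goo k.
  split; first exact: measurableX.
  by rewrite product_measure1E// lte_mul_pinfty// ge0_fin_numE.
have sf : sigma_finite setT (pm mC).
  pose D (t : n.+1.-tuple T) := (thead t, [tuple of behead t]).
  have mD : measurable_fun setT D.
    apply: measurable_fun_pair; last exact: measurable_behead.
    exact: measurable_tnth.
  exists (fun k => D @^-1` F k).
    by rewrite -preimage_bigcup -FT preimage_setT.
  move=> k; have [mF Foo] := FP k; split.
    by rewrite -[X in measurable X]setTI; exact: mD.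
  apply: le_lt_trans Foo; rewrite /pm/= /pushforward.
  rewrite (_ : C @^-1` _ = F k)//; apply/seteqP.
  have DC p : D (C p) = p.
    by case: p => x t; rewrite /D/= theadE; congr pair; exact: val_inj.
  by split=> p; rewrite /preimage/= DC.
by exists (sigma_finite_copy sf); rewrite /= IH.
Qed.

Lemma integral_powerS n (f : n.+1.-tuple T -> \bar R) :
  (forall t, 0 <= f t) -> measurable_fun setT f ->
  \int[power_measure mu n.+1]_t f t =
  \int[mu]_x \int[power_measure mu n]_t f [tuple of x :: t].
Proof.
move=> f0 mf /=; have [m ->] := power_measure_sigma_finite n.
have mC : measurable_fun setT (fun p : T * n.-tuple T => [tuple of p.1 :: p.2]).
  exact: measurable_cons_tuple.
rewrite ge0_integral_pushforward// preimage_setT fubini_tonelli1//.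
  exact: measurableT_comp.
by move=> p; exact: f0.
Qed.

Lemma integral_power_ge0 n (f : n.-tuple T -> \bar R) :
  (forall t, 0 <= f t) -> 0 <= \int[power_measure mu n]_t f t.
Proof.
by move=> f0; have [m ->] := power_measure_sigma_finite n; exact: integral_ge0.
Qed.

Lemma integral_functional_power n :
  integral_functional (fun f => \int[power_measure mu n]_t f t).
Proof.
have [m ->] := power_measure_sigma_finite n.
exact: integral_functional_integral.
Qed.

Lemma measurable_integral_power d' (Y : measurableType d') n
    (f : Y * n.-tuple T -> \bar R) : (forall p, 0 <= f p) ->
  measurable_fun setT f ->
  measurable_fun setT (fun y => \int[power_measure mu n]_t f (y, t)).
Proof.
move=> f0 mf; have [m ->] := power_measure_sigma_finite n.
have := @measurable_fun_fubini_tonelli_F _ _ _ _ R m f mf f0.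
exact.
Qed.

End power_measure_theory.

(** * Iterated integrals over a configuration *)

Definition tuples_in (T : Type) (S : set T) n : set (n.-tuple T) :=
  [set t | forall i, S (tnth t i)].
Arguments tuples_in {T} S n _.

Section config_power.
Context (R : realType) (X : completePseudoMetricType R).
Hypothesis hausdorffX : hausdorff_space X.
Context (U : nat -> set X) (baseU : is_base U).

Lemma integral_config_powerS (w : Omega X) n (f : n.+1.-tuple (borel X) -> \bar R) :
  (forall t, 0 <= f t) -> measurable_fun setT f ->
  \int[power_measure (config_measure w) n.+1]_t f t =
  \int[config_measure w]_x \int[power_measure (config_measure w) n]_t
    f [tuple of x :: t].
Proof.
have [mu <-] := config_sigma_finite_measure hausdorffX baseU w.
exact: integral_powerS.
Qed.

Lemma integral_config_power_ge0 (w : Omega X) n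
    (f : n.-tuple (borel X) -> \bar R) : (forall t, 0 <= f t) ->
  0 <= \int[power_measure (config_measure w) n]_t f t.
Proof.
have [mu <-] := config_sigma_finite_measure hausdorffX baseU w.
exact: integral_power_ge0.
Qed.

Lemma tuples_in0 (T : Type) (S : set T) : tuples_in S 0 = [set [tuple]].
Proof.
by apply/seteqP; split=> t; rewrite (tuple0 t)// => _ [].
Qed.

(** The iterated product of the counting measure of [w] counts the tuples with
    entries in [w]. *)
Lemma integral_config_power (w : Omega X) n (f : n.-tuple (borel X) -> \bar R) :
  (forall t, 0 <= f t) -> measurable_fun setT f ->
  \int[power_measure (config_measure w) n]_t f t =
  \esum_(t in tuples_in (points w : set (borel X)) n) f t.
Proof.
elim: n f => [|n IH] f f0 mf.
  by rewrite tuples_in0 esum_set1// integral_power0.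
have mfx x : measurable_fun setT (fun t : n.-tuple (borel X) => f [tuple of x :: t]).
  by apply: (measurableT_comp mf); exact: measurable_cons_tuple.
rewrite integral_config_powerS// integral_config; last 2 first.
- by move=> x; exact: integral_config_power_ge0.
- have [mu <-] := config_sigma_finite_measure hausdorffX baseU w.
  apply: (@measurable_integral_power _ _ _ mu _ _ n
    (fun p : borel X * n.-tuple (borel X) => f [tuple of p.1 :: p.2])) => //.
  by apply: (measurableT_comp mf); exact: measurable_cons_tuple.
under eq_esum do rewrite IH//.
rewrite esum_esum//.
rewrite [RHS](reindex_esum ((points w : set (borel X)) `*``
  (fun=> tuples_in (points w : set (borel X)) n)) _
  (fun p => [tuple of p.1 :: p.2]))//.
split=> [[x t] [/= wx wt] i|[x t] [y s] _ _ /(congr1 val)[-> /val_inj ->]//|t wt].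
  by have [j ->|->] := unliftP ord0 i; [rewrite tnthS|rewrite tnth0].
exists (thead t, [tuple of behead t]); last by rewrite /= -tuple_eta.
split=> [|i] /=; first exact: wt.
by rewrite tnth_behead; exact: wt.
Qed.

Hypothesis mass_measurable : forall A : set (borel X), measurable A ->
  measurable_fun setT (fun w : Omega X => config_measure w A).

Lemma measurable_integral_config_power n d (Y : measurableType d)
    (g : Y -> Omega X) (f : Y * n.-tuple (borel X) -> \bar R) :
  measurable_fun setT g -> (forall p, 0 <= f p) -> measurable_fun setT f ->
  measurable_fun setT
    (fun y => \int[power_measure (config_measure (g y)) n]_t f (y, t)).
Proof.
elim: n d Y g f => [|n IH] d Y g f mg f0 mf.
  rewrite (_ : (fun _ => _) = fun y => f (y, [tuple])).
    by apply: (measurableT_comp mf); exact: measurable_fun_pair.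
  apply/funext => y; rewrite integral_power0//.
  by apply: (measurableT_comp mf); exact: measurable_fun_pair.
have mf' : measurable_fun setT (fun p : (Y * borel X) * n.-tuple (borel X) =>
    f (p.1.1, [tuple of p.1.2 :: p.2])).
  apply: (measurableT_comp mf); apply: measurable_fun_pair.
    exact: measurableT_comp.
  by apply: measurable_cons_tuple => //; exact: measurableT_comp.
rewrite (_ : (fun _ => _) = fun y => \int[config_measure (g y)]_x
    \int[power_measure (config_measure (g y)) n]_t f (y, [tuple of x :: t])).
  apply: (measurable_integral_config hausdorffX baseU mass_measurable mg
    (f := fun p => \int[power_measure (config_measure (g p.1)) n]_t
      f (p.1, [tuple of p.2 :: t]))).
    by move=> p; exact: integral_config_power_ge0.
  by apply: (IH _ _ (g \o fst) _ _ _ mf') => //; exact: measurableT_comp.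
apply/funext => y; rewrite integral_config_powerS//.
by apply: (measurableT_comp mf); exact: measurable_fun_pair.
Qed.

Lemma measurable_uniq n : measurable [set t : n.-tuple (borel X) | uniq t].
Proof.
rewrite -[X in measurable X]setCK; apply: measurableC.
rewrite [X in measurable X](_ : _ = \bigcup_(p in [set p : 'I_n * 'I_n | p.1 != p.2])
    [set t : n.-tuple (borel X) | tnth t p.1 = tnth t p.2]); last first.
  apply/seteqP; split=> [t /= tu|t [[i j] /= ij tij] /tuple_uniqP/(_ _ _ tij)/eqP].
    apply: contrapT => nt; apply: tu; apply/tuple_uniqP => i j tij.
    by apply: contrapT => /eqP ij; apply: nt; exists (i, j).
  by rewrite (negbTE ij).
apply: fin_bigcup_measurable => // p _.
rewrite -[X in measurable X]setTI.
have mp : measurable_fun setT (fun t : n.-tuple (borel X) => (tnth t p.1, tnth t p.2)).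
  by apply: measurable_fun_pair; exact: measurable_tnth.
exact: (mp measurableT _ (measurable_diag hausdorffX baseU)).
Qed.

Lemma measurable_if_uniq d (Y : measurableType d) n (g : Y -> n.-tuple (borel X))
    (F : Y -> \bar R) : measurable_fun setT g -> measurable_fun setT F ->
  measurable_fun setT (fun y => if uniq (g y) then F y else 0).
Proof.
move=> mg mF; apply: measurable_fun_ifT => //.
apply: (@measurableT_comp _ _ _ _ _ _ (fun t : n.-tuple (borel X) => uniq t)) => //.
by apply: (measurable_fun_bool true); rewrite setTI; exact: measurable_uniq.
Qed.

End config_power.

(** * Adding points and the compound density *)

Section config_add_theory.
Context (R : realType) (X : completePseudoMetricType R).
Implicit Types (w : config X) (s : seq X) (x : X).

Lemma config_add0 w : config_add w [::] = w.
Proof. by apply: config_eq; apply/seteqP; split=> y /=; [case|left]. Qed.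

Lemma config_add_cons w x s :
  config_add w (x :: s) = config_add (config_add w s) [:: x].
Proof.
apply: config_eq; rewrite points_add1; apply/seteqP; split=> y /=.
  rewrite in_cons => -[wy|/predU1P[->|sy]]; [by right; left|by left|].
  by right; right.
by rewrite in_cons => -[->|[wy|->]]; [right; rewrite eqxx|left|right; rewrite orbT].
Qed.

Lemma config_addC w s s' :
  config_add (config_add w s) s' = config_add (config_add w s') s.
Proof. by apply: config_eq; rewrite /= -!setUA [X in _ `|` X]setUC. Qed.

Lemma config_add_rev w s : config_add w (rev s) = config_add w s.
Proof.
by apply: config_eq; apply/seteqP; split=> y /=; rewrite mem_rev.
Qed.

Lemma config_del_add w x : points w x -> config_add (config_del w x) [:: x] = w.
Proof. by move=> wx; apply: config_eq; rewrite points_add1 setD1K. Qed.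

Lemma compound_rec_rcons (c : borel X -> Omega X -> \bar R) s x (w : Omega X) :
  compound_rec c (rcons s x) w = c x (config_add w s) * compound_rec c s w.
Proof.
elim: s w => [|y s IH] w /=; first by rewrite config_add0.
by rewrite IH -config_addC -config_add_cons muleCA.
Qed.

(** The definition removes the last point and shifts the configuration of the
    remaining factors; read from the other end, the first point contributes one
    factor, in which all other points are already present. *)
Lemma compound_density_cons (c : borel X -> Omega X -> \bar R) s x (w : Omega X) :
  compound_density c (x :: s) w =
  c x (config_add w s) * compound_density c s w.
Proof.
by rewrite /compound_density rev_cons compound_rec_rcons config_add_rev.
Qed.

Hypothesis hausdorffX : hausdorff_space X.
Context (U : nat -> set X) (baseU : is_base U).
Hypothesis mass_measurable : forall A : set (borel X), measurable A ->
  measurable_fun setT (fun w : Omega X => config_measure w A).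

Lemma measurable_config_add n : measurable_fun setT
  (fun p : n.-tuple (borel X) * Omega X => config_add p.2 p.1 : Omega X).
Proof.
elim: n => [|n IH].
  rewrite (_ : (fun _ => _) = snd)//.
  by apply/funext => -[t w] /=; rewrite (tuple0 t) config_add0.
rewrite (_ : (fun _ => _) = fun p : n.+1.-tuple (borel X) * Omega X =>
    config_add (config_add p.2 [tuple of behead p.1]) [:: thead p.1]); last first.
  by apply/funext => -[t w] /=; rewrite -config_add_cons {1}(tuple_eta t).
have mt : measurable_fun setT
    (fun p : n.+1.-tuple (borel X) * Omega X => thead p.1).
  by apply: (measurableT_comp (f := fun t : n.+1.-tuple (borel X) => thead t)) => //;
    exact: measurable_tnth.
have mb : measurable_fun setT
    (fun p : n.+1.-tuple (borel X) * Omega X => ([tuple of behead p.1], p.2)).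
  apply: measurable_fun_pair => //.
  by apply: (measurableT_comp
    (f := fun t : n.+1.-tuple (borel X) => [tuple of behead t])) => //;
    exact: measurable_behead.
exact: (measurableT_comp (measurable_config_add1 hausdorffX baseU mass_measurable)
  (measurable_fun_pair mt (measurableT_comp IH mb))).
Qed.

Lemma measurable_shift n (w : Omega X) : measurable_fun setT
  (fun z : n.-tuple (borel X) => (z, config_add w z) :
    n.-tuple (borel X) * Omega X).
Proof.
apply: measurable_fun_pair => //.
exact: (measurableT_comp (@measurable_config_add n)
  (measurable_fun_pair (@measurable_id _ _ setT) (measurable_cst w))).
Qed.

Context (c : borel X -> Omega X -> \bar R).
Hypothesis c0 : forall x w, 0 <= c x w.
Hypothesis mc : measurable_fun setT (fun p : borel X * Omega X => c p.1 p.2).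

Lemma compound_density_ge0 s (w : Omega X) : 0 <= compound_density c s w.
Proof.
rewrite /compound_density; elim: (rev s) w => [//|x t IH] w /=.
by apply: mule_ge0.
Qed.

Lemma measurable_compound_density n : measurable_fun setT
  (fun p : n.-tuple (borel X) * Omega X => compound_density c p.1 p.2).
Proof.
elim: n => [|n IH].
  rewrite (_ : (fun _ => _) = cst 1); first exact: measurable_cst.
  by apply/funext => -[t w] /=; rewrite (tuple0 t).
rewrite (_ : (fun _ => _) = fun p : n.+1.-tuple (borel X) * Omega X =>
    c (thead p.1) (config_add p.2 [tuple of behead p.1]) *
    compound_density c [tuple of behead p.1] p.2); last first.
  by apply/funext => -[t w] /=; rewrite -compound_density_cons {1}(tuple_eta t).
have mt : measurable_fun setT
    (fun p : n.+1.-tuple (borel X) * Omega X => thead p.1).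
  by apply: (measurableT_comp (f := fun t : n.+1.-tuple (borel X) => thead t)) => //;
    exact: measurable_tnth.
have mb : measurable_fun setT
    (fun p : n.+1.-tuple (borel X) * Omega X => ([tuple of behead p.1], p.2)).
  apply: measurable_fun_pair => //.
  by apply: (measurableT_comp
    (f := fun t : n.+1.-tuple (borel X) => [tuple of behead t])) => //;
    exact: measurable_behead.
apply: emeasurable_funM; last exact: (measurableT_comp IH mb).
exact: (measurableT_comp mc
  (measurable_fun_pair mt (measurableT_comp (@measurable_config_add n) mb))).
Qed.

End config_add_theory.

(** * The Campbell formula *)

Section campbell.
Context (R : realType) (X : completePseudoMetricType R).
Hypothesis hausdorffX : hausdorff_space X.
Context (U : nat -> set X) (baseU : is_base U).
Context (lambda : {sigma_finite_measure set (borel X) -> \bar R}).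
Context (P : probability (Omega X) R) (c : borel X -> Omega X -> \bar R).
Hypothesis c_density : papangelou_density lambda P c.

(** The Campbell integrand of [A] and of the whole configuration space is the
    mass of [A]. *)
Lemma papangelou_mass_measurable (A : set (borel X)) : measurable A ->
  measurable_fun setT (fun w : Omega X => config_measure w A).
Proof.
move=> mA; have [_ _ mC _] := c_density.
rewrite (_ : (fun _ => _) = campbell_integrand A setT); first exact: mC.
apply/funext => w; rewrite /campbell_integrand.
rewrite -[LHS]mul1e -(integral_cst _ mA).
by apply: eq_integral => x _; rewrite indicT.
Qed.

Let mass := papangelou_mass_measurable.

Let c0 x w : 0 <= c x w. Proof. by have [] := c_density. Qed.

Let mc : measurable_fun setT (fun p : borel X * Omega X => c p.1 p.2).
Proof. by have [] := c_density. Qed.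

Let mdel := measurable_config_del hausdorffX baseU mass.

Let mdel_pair : measurable_fun setT (fun p : Omega X * borel X =>
  (p.2, config_del p.1 p.2) : borel X * Omega X).
Proof.
apply: measurable_fun_pair => //.
exact: (measurableT_comp mdel
  (measurable_fun_pair measurable_snd measurable_fst)).
Qed.

Let config_measure_del (w : Omega X) (x : borel X) A : points w x ->
  config_measure w A = \d_x A + config_measure (config_del w x) A.
Proof.
move=> wx; rewrite /config_measure (esumID ([set x] : set (borel X)))//.
by rewrite setI1 mem_set// esum_set1.
Qed.

Let mphi (w : Omega X) : measurable_fun setT
  (fun x : borel X => (x, config_del w x) : borel X * Omega X).
Proof.
apply: measurable_fun_pair => //.
exact: (measurableT_comp mdel (measurable_fun_pair (@measurable_id _ _ _) (measurable_cst w))).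
Qed.

Let Cam (f : borel X * Omega X -> \bar R) :=
  \int[P]_w \int[config_measure w]_x f (x, config_del w x).

Let Den (f : borel X * Omega X -> \bar R) :=
  \int[lambda \x P]_p (c p.1 p.2 * f p).

Let II : integral_functional Cam.
Proof.
pose K (w : Omega X) (f : borel X * Omega X -> \bar R) :=
  \int[config_measure w]_x f (x, config_del w x).
apply: (@integral_functional_comp _ _ _ _ _ (fun h => \int[P]_w h w) K).
- exact: integral_functional_integral.
- move=> w; exact: (integral_functional_pullback
    (integral_functional_integral (config_measure w)) (mphi w)).
- move=> f f0 mf; apply: (measurable_integral_config hausdorffX baseU mass
    (g := id) _ (f := fun p => f (p.2, config_del p.1 p.2))) => //.
  exact: (measurableT_comp mf mdel_pair).
Qed.

Let IJ : integral_functional Den.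
Proof.
exact: (integral_functional_density (integral_functional_integral _)).
Qed.

Let IJ_rect (A : set (borel X)) (B : set (Omega X)) :
  measurable A -> measurable B ->
  Cam (fun p => (\1_(A `*` B) p)%:E) = Den (fun p => (\1_(A `*` B) p)%:E).
Proof.
move=> mA mB; have [_ _ _ /(_ A B mA mB)] := c_density.
rewrite /campbell /campbell_integrand [RHS]integral_mkcond => cAB.
transitivity (\int[P]_w \int[config_measure w]_(x in A)
    (\1_B (config_del w x : Omega X))%:E).
  apply: eq_integral => w _; rewrite [RHS]integral_mkcond.
  apply: eq_integral => x _; rewrite /patch !indicE in_setX /=.
  by case: (x \in A).
rewrite cAB; apply: eq_integral => -[x w] _; rewrite /patch indicE.
by case: (_ \in _); rewrite ?mule1 ?mule0.
Qed.

Let measurable_light_set n : measurable (light U n : set (Omega X)).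
Proof.
have := measurable_light baseU mass n measurableT.
by move=> /(_ [set true] I); rewrite setTI.
Qed.

(** If [x] is a point of [w] in [U n] and [w \ x] has at most one point there,
    then [w] has at most two points in [U n]. *)
Let I_cover n : Cam (fun p => (\1_(U n `*` light U n) p)%:E) < +oo.
Proof.
have mU := base_borel baseU n.
suff I2 (w : Omega X) : \int[config_measure w]_x
    (\1_(U n `*` light U n) (x, config_del w x))%:E <= 2%:E.
  apply: (@le_lt_trans _ _ (\int[P]_w (cst 2%:E) w)); last first.
    rewrite integral_cst//.
    rewrite [X in _ * X](_ : _ = 1); last exact: probability_setT.
    by rewrite mule1 ltry.
  apply: ge0_le_integral => //.
  - by move=> w _; apply: integral_ge0 => x _; rewrite lee_fin indicE.
  - apply: (measurable_integral_config hausdorffX baseU mass (g := id) _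
      (f := fun p => (\1_(U n `*` light U n) (p.2, config_del p.1 p.2))%:E)) => //.
    apply/measurable_EFinP.
    apply: (@measurableT_comp _ _ _ _ _ _
      (\1_(U n `*` light U n) : borel X * Omega X -> R)).
      by apply: measurable_indic; exact: measurableX.
    exact: mdel_pair.
have mh : measurable_fun setT (fun x : borel X =>
    (\1_(U n `*` light U n) (x, config_del w x))%:E : \bar R).
  apply/measurable_EFinP.
  apply: (@measurableT_comp _ _ _ _ _ _
    (\1_(U n `*` light U n) : borel X * Omega X -> R)) => //.
  by apply: measurable_indic; exact: measurableX.
have h0 x : 0 <= (\1_(U n `*` light U n) (x, config_del w x))%:E :> \bar R.
  by rewrite lee_fin indicE.
have [[x0 [wx0 Ux0 lx0]]|nx0] := pselect (exists x0,
    [/\ points w x0, U n x0 & light U n (config_del w x0)]).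
  apply: (@le_trans _ _ (\int[config_measure w]_x (\1_(U n) x)%:E)).
    apply: ge0_le_integral => //.
    - by apply/measurable_EFinP; exact: measurable_indic.
    - move=> x _; rewrite lee_fin !indicE in_setX /=.
      by case: (x \in U n) => //=; case: (_ \in _).
  rewrite integral_indic// setIT [leLHS](_ : _ = \d_(x0 : borel X) (U n) +
    config_measure (config_del w x0) (U n)); last exact: config_measure_del.
  rewrite (natrD _ 1 1) EFinD; apply: leeD => //.
  by rewrite diracE; case: (_ \in _).
rewrite integral_config// esum1// => x wx; rewrite indicE memNset//.
by move=> [/= Unx lx]; apply: nx0; exists x.
Qed.

(** Both sides are integral functionals of [f]; they agree on rectangles by the
    definition of the density, and the rectangles of [I_cover] make the Campbell
    measure sigma-finite. *)
Lemma campbell_formula (f : borel X * Omega X -> \bar R) :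
  (forall p, 0 <= f p) -> measurable_fun setT f ->
  \int[P]_w \int[config_measure w]_x f (x, config_del w x) =
  \int[lambda]_x \int[P]_w (c x w * f (x, w)).
Proof.
move=> f0 mf; transitivity (Den f); last first.
  rewrite /Den fubini_tonelli1//; first exact: emeasurable_funM.
  by move=> p; apply: mule_ge0.
apply: (integral_functional_unique II IJ
  (G := [set A `*` B | A in measurable & B in measurable])
  (g := fun n => U n `*` light U n)) => //.
- exact: measurable_prod_measurableType.
- move=> _ _ [A mA [B mB <-]] [A' mA' [B' mB' <-]].
  exists (A `&` A'); first exact: measurableI.
  by exists (B `&` B'); [exact: measurableI|rewrite setXI].
- move=> n; exists (U n); first exact: (base_borel baseU).
  by exists (light U n).
- rewrite -subTset => -[x w] _.
  have [n [Unx Uw]] := base_isolated hausdorffX baseU w x.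
  by exists n => //; split=> //=; rewrite /light (config_measure_le1 Uw).
- by move=> _ [A mA [B mB <-]]; exact: IJ_rect.
Qed.

End campbell.

(** * The Campbell formula for tuples of distinct points *)

Section multivariate_campbell.
Context (R : realType) (X : completePseudoMetricType R).
Hypothesis hausdorffX : hausdorff_space X.
Context (U : nat -> set X) (baseU : is_base U).
Context (lambda : {sigma_finite_measure set (borel X) -> \bar R}).
Context (P : probability (Omega X) R) (c : borel X -> Omega X -> \bar R).
Hypothesis c_density : papangelou_density lambda P c.

Let mass := papangelou_mass_measurable c_density.

Let c0 x w : 0 <= c x w. Proof. by have [] := c_density. Qed.

Let mc : measurable_fun setT (fun p : borel X * Omega X => c p.1 p.2).
Proof. by have [] := c_density. Qed.

Lemma ge0_integral_powerZl d (T : measurableType d)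
    (mu : {sigma_finite_measure set T -> \bar R}) n (k : \bar R)
    (f : n.-tuple T -> \bar R) : 0 <= k -> (forall t, 0 <= f t) ->
  measurable_fun setT f -> \int[power_measure mu n]_t (k * f t) =
  k * \int[power_measure mu n]_t f t.
Proof.
move=> k0 f0 mf; have [m ->] := power_measure_sigma_finite mu n.
exact: ge0_integralZl.
Qed.

Lemma ge0_integral_config_powerZl (w : Omega X) n (k : \bar R)
    (f : n.-tuple (borel X) -> \bar R) : 0 <= k -> (forall t, 0 <= f t) ->
  measurable_fun setT f -> \int[power_measure (config_measure w) n]_t (k * f t) =
  k * \int[power_measure (config_measure w) n]_t f t.
Proof.
have [mu <-] := config_sigma_finite_measure hausdorffX baseU w.
exact: ge0_integral_powerZl.
Qed.

Lemma tuples_in_del (w : Omega X) (x : borel X) n :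
  tuples_in (points (config_del w x) : set (borel X)) n =
  tuples_in (points w : set (borel X)) n `&` [set t | x \notin t].
Proof.
apply/seteqP; split=> [t wt|t [wt xt] i].
  split=> [i|]; first by have [] := wt i.
  by apply/negP => /tnthP[i xi]; have [_] := wt i; apply; rewrite -xi.
by split=> // xi; move/negP: xt; apply; rewrite -xi mem_tnth.
Qed.

Let measurable_if_uniq d (Y : measurableType d) n (g : Y -> n.-tuple (borel X))
    (F : Y -> \bar R) : measurable_fun setT g -> measurable_fun setT F ->
  measurable_fun setT (fun y => if uniq (g y) then F y else 0).
Proof. exact: (measurable_if_uniq hausdorffX baseU). Qed.

Let measurable_add d (Y : measurableType d) n (g : Y -> n.-tuple (borel X))
    (h : Y -> Omega X) : measurable_fun setT g -> measurable_fun setT h ->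
  measurable_fun setT (fun y => config_add (h y) (g y) : Omega X).
Proof.
move=> mg mh; exact: (measurableT_comp
  (measurable_config_add hausdorffX baseU mass (n := n)) (measurable_fun_pair mg mh)).
Qed.

Let measurable_add1 d (Y : measurableType d) (g : Y -> borel X)
    (h : Y -> Omega X) : measurable_fun setT g -> measurable_fun setT h ->
  measurable_fun setT (fun y => config_add (h y) [:: g y] : Omega X).
Proof.
move=> mg mh; exact: (measurableT_comp
  (measurable_config_add1 hausdorffX baseU mass) (measurable_fun_pair mg mh)).
Qed.

Let measurable_density d (Y : measurableType d) n (g : Y -> n.-tuple (borel X))
    (h : Y -> Omega X) : measurable_fun setT g -> measurable_fun setT h ->
  measurable_fun setT (fun y => compound_density c (g y) (h y)).
Proof.
move=> mg mh; exact: (measurableT_comp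
  (measurable_compound_density hausdorffX baseU mass mc (n := n))
  (measurable_fun_pair mg mh)).
Qed.

Let density0 s w : 0 <= compound_density c s w.
Proof. exact: compound_density_ge0. Qed.

(** Induction on the number of points.  The Campbell formula is applied to the
    function [f (x, w)] that sums [F (x :: z) (w U x)] over the tuples [z] of
    distinct points of [w]: deleting [x] from [w] removes the tuples through [x],
    so that the restriction to [uniq (x :: z)] appears by itself. *)
Lemma multivariate_campbell n (F : n.-tuple (borel X) -> Omega X -> \bar R) :
  (forall z w, 0 <= F z w) ->
  measurable_fun setT (fun p : n.-tuple (borel X) * Omega X => F p.1 p.2) ->
  \int[P]_w \int[power_measure (config_measure w) n]_z
    (if uniq z then F z w else 0) =
  \int[P]_w \int[power_measure lambda n]_z
    (compound_density c z w * F z (config_add w z)).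
Proof.
elim: n F => [|n IH] F F0 mF.
  have mFc d (Y : measurableType d) g h : measurable_fun setT g ->
      measurable_fun setT h -> measurable_fun setT (fun y : Y => F (g y) (h y)).
    by move=> mg mh; exact: (measurableT_comp mF (measurable_fun_pair mg mh)).
  apply: eq_integral => w _; rewrite !integral_power0/=.
  - by rewrite compound_density0 mul1e config_add0.
  - apply: emeasurable_funM; first exact: measurable_density.
    by apply: mFc => //; exact: measurable_add.
  - by apply: measurable_if_uniq => //; exact: mFc.
have mFc d (Y : measurableType d) g h : measurable_fun setT g ->
    measurable_fun setT h -> measurable_fun setT (fun y : Y => F (g y) (h y)).
  by move=> mg mh; exact: (measurableT_comp mF (measurable_fun_pair mg mh)).
pose f (p : borel X * Omega X) := \int[power_measure (config_measure p.2) n]_z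
  (if uniq z then F [tuple of p.1 :: z] (config_add p.2 [:: p.1]) else 0).
have f0 p : 0 <= f p.
  by apply: (integral_config_power_ge0 hausdorffX baseU) => z; case: ifP.
have mf : measurable_fun setT f.
  apply: (@measurable_integral_config_power _ _ hausdorffX _ baseU mass n _ _
    snd (fun q => if uniq q.2 then F [tuple of q.1.1 :: q.2]
      (config_add q.1.2 [:: q.1.1]) else 0)) => //.
    by move=> q; case: ifP.
  apply: measurable_if_uniq => //; apply: mFc.
    by apply: measurable_cons_tuple => //; exact: measurableT_comp.
  by apply: measurable_add1; exact: measurableT_comp.
transitivity (\int[P]_w \int[config_measure w]_x f (x, config_del w x)).
  apply: eq_integral => w _.
  have mFw : measurable_fun setT (F ^~ w) by exact: mFc.
  rewrite (integral_config_powerS hausdorffX baseU); last 2 first.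
  - by move=> t; case: ifP.
  - exact: measurable_if_uniq.
  have mdel := measurable_config_del hausdorffX baseU mass.
  rewrite [LHS]integral_config; last 2 first.
  - move=> x; apply: (integral_config_power_ge0 hausdorffX baseU) => z.
    by case: ifP.
  - apply: (@measurable_integral_config_power _ _ hausdorffX _ baseU mass n _ _
      (fun=> w) (fun q => if uniq [tuple of q.1 :: q.2] then
        F [tuple of q.1 :: q.2] w else 0)) => //.
      by move=> q; case: ifP.
    apply: measurable_if_uniq; first exact: measurable_cons_tuple.
    by apply: mFc => //; exact: measurable_cons_tuple.
  rewrite [RHS]integral_config; last 2 first.
  - by [].
  - apply: (measurableT_comp mf); apply: measurable_fun_pair => //.
    exact: (measurableT_comp mdel (measurable_fun_pair (@measurable_id _ _ _) (measurable_cst w))).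
  (* Adding the deleted point again restores [w]. *)
  apply: eq_esum => x wx.
  have -> : f (x, config_del w x) =
      \int[power_measure (config_measure (config_del w x)) n]_z
        (if uniq z then F [tuple of x :: z] w else 0).
    by apply: eq_integralT => z; rewrite [config_add _ _]config_del_add.
  rewrite !(integral_config_power hausdorffX baseU); last 4 first.
  - by move=> t; case: ifP.
  - by apply: measurable_if_uniq => //; apply: mFc => //; exact: measurable_cons_tuple.
  - by move=> t; case: ifP.
  - apply: (@measurable_if_uniq _ _ n.+1 (fun z : n.-tuple (borel X) =>
        [tuple of x :: z]) (fun z => F [tuple of x :: z] w)).
      exact: measurable_cons_tuple.
    by apply: mFc => //; exact: measurable_cons_tuple.
  rewrite tuples_in_del esum_mkcondr; apply: eq_esum => z _ /=.
  have [xz|xz] := boolP (x \in z).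
    by rewrite memNset//= xz.
  by rewrite mem_set.

rewrite (campbell_formula hausdorffX baseU c_density f0 mf).
have mH d (Y : measurableType d) (g1 : Y -> borel X) (g2 : Y -> n.-tuple (borel X))
    (h : Y -> Omega X) : measurable_fun setT g1 -> measurable_fun setT g2 ->
    measurable_fun setT h -> measurable_fun setT (fun y =>
      compound_density c (g2 y) (h y) * (c (g1 y) (config_add (h y) (g2 y)) *
      F [tuple of g1 y :: g2 y] (config_add (h y) [tuple of g1 y :: g2 y]))).
  move=> m1 m2 mh; apply: emeasurable_funM; first exact: measurable_density.
  apply: emeasurable_funM.
    by apply: (measurableT_comp mc (measurable_fun_pair m1 _)); exact: measurable_add.
  apply: mFc; first exact: measurable_cons_tuple.
  by apply: measurable_add => //; exact: measurable_cons_tuple.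
transitivity (\int[lambda]_x \int[P]_w \int[power_measure lambda n]_z
    (compound_density c z w *
     (c x (config_add w z) * F [tuple of x :: z] (config_add w [tuple of x :: z])))).
  apply: eq_integral => x _.
  pose G (z : n.-tuple (borel X)) (w : Omega X) := c x w * F [tuple of x :: z] (config_add w [:: x]).
  transitivity (\int[P]_w \int[power_measure (config_measure w) n]_z
      (if uniq z then G z w else 0)).
    apply: eq_integral => w _; rewrite /f/= -ge0_integral_config_powerZl//.
    - by apply: eq_integralT => z; case: ifP => _; rewrite ?mule0.
    - by move=> t; case: ifP.
    - by apply: measurable_if_uniq => //; apply: mFc => //; exact: measurable_cons_tuple.
  rewrite IH.
  - apply: eq_integral => w _; apply: eq_integralT => z; congr (_ * (_ * F _ _)).
    by rewrite -config_add_cons.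
  - by move=> z w; apply: mule_ge0.
  - apply: emeasurable_funM.
      exact: (measurableT_comp mc
        (measurable_fun_pair (measurable_cst x) measurable_snd)).
    apply: mFc; first exact: measurable_cons_tuple.
    exact: measurable_add1.
pose H (p : borel X * Omega X) := \int[power_measure lambda n]_z
  (compound_density c z p.2 * (c p.1 (config_add p.2 z) *
    F [tuple of p.1 :: z] (config_add p.2 [tuple of p.1 :: z]))).
have H0 p : 0 <= H p.
  by apply: integral_power_ge0 => z; apply: mule_ge0 => //; apply: mule_ge0.
have mHH : measurable_fun setT H.
  apply: (@measurable_integral_power _ _ _ lambda _ _ n (fun q : (borel X * Omega X) *
      n.-tuple (borel X) => compound_density c q.2 q.1.2 *
      (c q.1.1 (config_add q.1.2 q.2) *
       F [tuple of q.1.1 :: q.2] (config_add q.1.2 [tuple of q.1.1 :: q.2])))).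
    by move=> q; apply: mule_ge0 => //; apply: mule_ge0.
  by apply: mH => //; exact: measurableT_comp.
transitivity (\int[P]_w \int[lambda]_x H (x, w)).
  exact: (@fubini_tonelli _ _ _ _ R lambda P H mHH H0).
apply: eq_integral => w _; rewrite integral_powerS.
- apply: eq_integral => x _; apply: eq_integralT => z.
  by rewrite compound_density_cons muleCA muleA.
- by move=> t; apply: mule_ge0.
- apply: emeasurable_funM; first exact: measurable_density.
  by apply: mFc => //; exact: measurable_add.
Qed.

(** The compound density is measurable in the points, so [lambda_hat] is a
    measure, against which finite sums can be integrated term by term. *)
Lemma lambda_hat_measure (w : Omega X) n :
  exists2 m : {measure set (n.-tuple (borel X)) -> \bar R},
    lambda_hat lambda c n w = m &
    forall f, (forall z, 0 <= f z) -> measurable_fun setT f ->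
      \int[m]_z f z =
      \int[power_measure lambda n]_z (compound_density c z w * f z).
Proof.
pose h (z : n.-tuple (borel X)) := compound_density c z w.
have mh : measurable_fun setT h by exact: measurable_density.
have D := integral_functional_density (integral_functional_power lambda n)
  (h := h) (fun z => density0 z w) mh.
have hatE A : \int[power_measure lambda n]_(z in A) h z =
    \int[power_measure lambda n]_z (h z * (\1_A z)%:E).
  have [m ->] := power_measure_sigma_finite lambda n.
  rewrite integral_mkcond; apply: eq_integralT => z; rewrite /patch indicE.
  by case: (_ \in _); rewrite ?mule1 ?mule0.
exists (functional_measure D); last exact: integral_functional_measure.
by apply/funext => A; exact: hatE.
Qed.

Lemma integral_lambda_hat (w : Omega X) n (f : n.-tuple (borel X) -> \bar R) :
  (forall z, 0 <= f z) -> measurable_fun setT f ->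
  \int[lambda_hat lambda c n w]_z f z =
  \int[power_measure lambda n]_z (compound_density c z w * f z).
Proof. by move=> f0 mf; have [m -> ->] := lambda_hat_measure w n. Qed.

Lemma measurable_integral_lambda_hat n
    (f : n.-tuple (borel X) -> Omega X -> \bar R) :
  (forall z w, 0 <= f z w) ->
  measurable_fun setT (fun p : n.-tuple (borel X) * Omega X => f p.1 p.2) ->
  measurable_fun setT (fun w : Omega X =>
    \int[lambda_hat lambda c n w]_z f z (config_add w z)).
Proof.
move=> f0 mf.
have mfa d (Y : measurableType d) (g : Y -> n.-tuple (borel X)) (h : Y -> Omega X) :
    measurable_fun setT g -> measurable_fun setT h ->
    measurable_fun setT (fun y => f (g y) (config_add (h y) (g y))).
  move=> mg mh; exact: (measurableT_comp mf
    (measurable_fun_pair mg (measurable_add mg mh))).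
rewrite (_ : (fun _ => _) = fun w => \int[power_measure lambda n]_z
    (compound_density c z w * f z (config_add w z))); last first.
  apply/funext => w; rewrite integral_lambda_hat//.
  exact: mfa.
apply: (@measurable_integral_power _ _ _ lambda _ _ n (fun q : Omega X *
    n.-tuple (borel X) => compound_density c q.2 q.1 *
    f q.2 (config_add q.1 q.2))).
  by move=> q; apply: mule_ge0.
by apply: emeasurable_funM; [exact: measurable_density|exact: mfa].
Qed.

End multivariate_campbell.

(** * Arrays sorted by their kernel partitions *)

Section kernel_partition.
Context (n r : nat) (T : choiceType).
Implicit Types (rho : grid_partition n r).

Lemma block_elt_subproof rho (p : 'I_#|val rho|) :
  exists kl : 'I_n * 'I_r, kl \in enum_val p.
Proof.
apply/set0Pn; apply: contraTneq (enum_valP p) => ->.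
by have /and3P[] := valP rho.
Qed.

Definition block_elt rho (p : 'I_#|val rho|) : 'I_n * 'I_r :=
  xchoose (block_elt_subproof p).

Lemma zeta_block_elt rho p : zeta rho (block_elt p) = p.
Proof. by apply/zetaP; exact: xchooseP. Qed.

Lemma zeta_eq rho kl kl' :
  (zeta rho kl == zeta rho kl') = (kl' \in finset.pblock (val rho) kl).
Proof.
have klP : finset.pblock (val rho) kl = enum_val (zeta rho kl).
  by rewrite /zeta enum_rankK_in// pblock_grid.
rewrite klP eq_sym; apply/eqP/idP => [/zetaP//|/zetaP//].
Qed.

Definition array_entry (g : n.-tuple (r.-tuple T)) (kl : 'I_n * 'I_r) : T :=
  tnth (tnth g kl.1) kl.2.

Definition kernel_partition (g : n.-tuple (r.-tuple T)) : grid_partition n r :=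
  exist _ (preim_partition (array_entry g) [set: 'I_n * 'I_r]%SET)
    (preim_partitionP _ _).

Definition array_of rho (z : #|val rho|.-tuple T) : n.-tuple (r.-tuple T) :=
  [tuple zrow rho z k | k < n].

Lemma array_entry_of rho z kl : array_entry (@array_of rho z) kl = tnth z (zeta rho kl).
Proof. by case: kl => k l; rewrite /array_entry !tnth_mktuple. Qed.

Lemma kernel_partition_pblock (g : n.-tuple (r.-tuple T)) kl kl' :
  (kl' \in finset.pblock (val (kernel_partition g)) kl) =
  (array_entry g kl == array_entry g kl').
Proof.
rewrite /= pblock_equivalence_partition ?inE//.
by split=> // /eqP ->.
Qed.

Lemma kernel_partition_array_of rho (z : #|val rho|.-tuple T) : uniq z ->
  kernel_partition (@array_of rho z) = rho.
Proof.
move=> /tuple_uniqP uz; apply: val_inj => /=.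
rewrite -[RHS](equivalence_partition_pblock (valP rho)).
rewrite /preim_partition /equivalence_partition.
apply: eq_imset => kl; apply/setP => kl'; rewrite !inE/=.
by rewrite !array_entry_of (inj_eq uz) zeta_eq.
Qed.

(** An array with kernel [rho] takes one value on each block and distinct values
    on distinct blocks: it is a tuple without repetition, indexed by the
    blocks. *)
Lemma kernel_partition_bij (S : set T) rho :
  set_bij [set z : #|val rho|.-tuple T | tuples_in S #|val rho| z /\ uniq z]
    [set g | tuples_in (tuples_in S r) n g /\ kernel_partition g = rho]
    (@array_of rho).
Proof.
split.
- move=> z [/= zS uz]; split; last exact: kernel_partition_array_of.
  by move=> k l; rewrite !tnth_mktuple; exact: zS.
- move=> z z' _ _ E; apply: eq_from_tnth => p.
  by rewrite -(zeta_block_elt p) -!array_entry_of E.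
- move=> g [/= gS gE].
  have entry_eq kl kl' : (zeta rho kl == zeta rho kl') =
      (array_entry g kl == array_entry g kl').
    by rewrite zeta_eq -gE kernel_partition_pblock.
  exists [tuple array_entry g (block_elt p) | p < #|val rho|].
    split=> [p|]; first by rewrite tnth_mktuple; exact: gS.
    apply/tuple_uniqP => p q; rewrite !tnth_mktuple => /eqP.
    by rewrite -entry_eq !zeta_block_elt => /eqP.
  apply: eq_from_tnth => k; apply: eq_from_tnth => l.
  rewrite -[LHS]/(array_entry _ (k, l)) -[RHS]/(array_entry _ (k, l)).
  rewrite array_entry_of tnth_mktuple; apply/eqP.
  by rewrite -entry_eq zeta_block_elt.
Qed.

(** Two cells of one row in the same block carry the same entry. *)
Lemma flat_row (g : n.-tuple (r.-tuple T)) : ~~ nonflat (kernel_partition g) ->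
  exists k, ~~ uniq (tnth g k).
Proof.
rewrite negb_forall => /existsP[k]; rewrite negb_forall_in => /existsP[B].
rewrite -ltnNge => /andP[gB] /card_gt1P[[k1 l1] [[k2 l2] []]].
rewrite !inE/= => /andP[/eqP -> B1] /andP[/eqP -> B2] neq.
exists k; apply/tuple_uniqP => inj; move/eqP: neq; apply; congr pair.
have /and3P[_ tI _] := valP (kernel_partition g).
apply: inj; apply/eqP.
by rewrite -[_ == _](kernel_partition_pblock g (k, l1) (k, l2)) (def_pblock tI gB B1).
Qed.

End kernel_partition.

Section power_expansion.
Context (R : realType).

Lemma prod_esum (Z : choiceType) (A : set Z) n (v : 'I_n -> Z -> \bar R) :
  (forall k z, 0 <= v k z) ->
  \prod_(k < n) (\esum_(z in A) v k z) =
  \esum_(g in tuples_in A n) \prod_(k < n) v k (tnth g k).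
Proof.
elim: n v => [|n IH] v v0.
  by rewrite big_ord0 tuples_in0 esum_set1 big_ord0.
rewrite big_ord_recl IH// muleC -ge0_esumZl//; last first.
  by apply: esum_ge0 => g _; apply: prode_ge0.
have p0 (g : n.-tuple Z) : 0 <= \prod_(i < n) v (lift ord0 i) (tnth g i).
  exact: prode_ge0.
under eq_esum do rewrite muleC -ge0_esumZl//.
rewrite esum_esum; last by move=> z g _ _; exact: mule_ge0.
rewrite [RHS](reindex_esum (A `*`` (fun=> tuples_in A n)) _
  (fun p => [tuple of p.1 :: p.2]))/=.
  apply: eq_esum => -[z g] _ /=; rewrite big_ord_recl tnth0; congr (_ * _).
  by apply: eq_bigr => i _; rewrite tnthS.
split=> [[x t] [/= wx wt] i|[x t] [y s] _ _ /(congr1 val)[-> /val_inj ->]//|t wt].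
  by have [j ->|->] := unliftP ord0 i; [rewrite tnthS|rewrite tnth0].
exists (thead t, [tuple of behead t]); last by rewrite /= -tuple_eta.
split=> [|i] /=; first exact: wt.
by rewrite tnth_behead; exact: wt.
Qed.

(** Expand the product into a sum over arrays and sort them by their kernels;
    the arrays with a flat kernel contribute 0. *)
Lemma prod_esum_nonflat (T : choiceType) (S : set T) n r
    (v : 'I_n -> r.-tuple T -> \bar R) :
  (forall k z, 0 <= v k z) -> (forall k (z : r.-tuple T), ~~ uniq z -> v k z = 0) ->
  \prod_(k < n) (\esum_(z in tuples_in S r) v k z) =
  \sum_(rho : grid_partition n r | nonflat rho)
    \esum_(z in tuples_in S #|val rho|)
      (if uniq z then \prod_(k < n) v k (zrow rho z k) else 0).
Proof.
move=> v0 vu; rewrite prod_esum//.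
pose h (g : n.-tuple (r.-tuple T)) := \prod_(k < n) v k (tnth g k).
have h0 g : 0 <= h g by exact: prode_ge0.
transitivity (\esum_(g in tuples_in (tuples_in S r) n)
    \sum_(rho : grid_partition n r | nonflat rho)
      (if kernel_partition g == rho then h g else 0)).
  apply: eq_esum => g _.
  have [fg|fg] := boolP (nonflat (kernel_partition g)).
    rewrite (bigD1 (kernel_partition g))//= eqxx [X in _ + X]big1 ?adde0// => rho /andP[_].
    by rewrite eq_sym => /negbTE ->.
  rewrite [RHS]big1 => [|rho fr]; last first.
    by case: eqP => // gr; rewrite gr fr in fg.
  have [k nuk] := flat_row fg.
  by rewrite -/(h g) /h (bigD1 k)//= vu// mul0e.
rewrite esum_sum; last by move=> g rho _ _; case: ifP.
apply: eq_bigr => rho _.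
transitivity (\esum_(g in tuples_in (tuples_in S r) n `&`
    [set g | kernel_partition g = rho]) h g).
  rewrite esum_mkcondr; apply: eq_esum => g _; congr (if _ then _ else _).
  by apply/eqP/idP => [gr|/set_mem//]; exact: mem_set.
rewrite (reindex_esum _ _ _ _ (kernel_partition_bij S rho)).
rewrite [RHS](_ : _ = \esum_(z in tuples_in S #|val rho| `&` [set z | uniq z])
    \prod_(k < n) v k (zrow rho z k)).
  apply: eq_esum => z _; apply: eq_bigr => k _.
  by rewrite tnth_mktuple.
rewrite esum_mkcondr; apply: eq_esum => z _.
have [uz|uz] := boolP (uniq z); first by rewrite mem_set.
by rewrite memNset//=; exact/negP.
Qed.

End power_expansion.

(** * Splitting a product by parity *)

Section moment_preliminaries.
Context (R : realType).

Lemma emeasurable_prod d (T : measurableType d) (I : Type) (s : seq I)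
    (h : I -> T -> \bar R) : (forall i, measurable_fun setT (h i)) ->
  measurable_fun setT (fun x => \prod_(i <- s) h i x).
Proof.
move=> mh; elim: s => [|i s IH].
  by under eq_fun do rewrite big_nil; exact: measurable_cst.
by under eq_fun do rewrite big_cons; exact: emeasurable_funM.
Qed.

Lemma prode_const (k : nat) (x : \bar R) : \prod_(i < k) x = x ^+ k.
Proof. by elim: k => [|k IH]; rewrite ?big_ord0// big_ord_recl IH expeS. Qed.

(** [a] and [b] are the positive and the negative part of [a - b] as soon as
    nothing cancels. *)
Lemma max_of_norm (a b : R) : (0 <= a)%R -> (0 <= b)%R ->
  `|a - b|%R = (a + b)%R ->
  Num.max (a - b)%R 0%R = a /\ Num.max (- (a - b))%R 0%R = b.
Proof.
move=> a0 b0; case: (lerP 0 (a - b)%R) => ab.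
  rewrite ger0_norm// => E; have -> : b = 0%R by lra.
  by rewrite subr0; split=> //; rewrite max_r// oppr_le0.
rewrite ltr0_norm// => E; have -> : a = 0%R by lra.
by split=> //; rewrite sub0r opprK max_l.
Qed.

End moment_preliminaries.

Section parity_expansion.
Local Open Scope ring_scope.
Context (R : realFieldType) (n : nat).

(** [s k] selects the first of the two terms of the [k]-th factor; the parity is
    that of the number of second terms. *)
Definition even_choice (s : {ffun 'I_n -> bool}) : bool :=
  ~~ odd #|[pred k | ~~ s k]|.

Definition parity_sum (p : bool) (a b : 'I_n -> R) : R :=
  \sum_(s : {ffun 'I_n -> bool} | even_choice s == p)
    \prod_(k < n) (if s k then a k else b k).

Lemma prod_expand (a b : 'I_n -> R) : \prod_(k < n) (a k + b k) =
  \sum_(s : {ffun 'I_n -> bool}) \prod_(k < n) (if s k then a k else b k).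
Proof.
rewrite -(bigA_distr_bigA (fun k (j : bool) => if j then a k else b k)).
by apply: eq_bigr => k _; rewrite big_bool.
Qed.

Lemma parity_sumE (e : bool -> R) (a b : 'I_n -> R) :
  e true * parity_sum true a b + e false * parity_sum false a b =
  \sum_(s : {ffun 'I_n -> bool})
    e (even_choice s) * \prod_(k < n) (if s k then a k else b k).
Proof.
rewrite [RHS](bigID even_choice)/= /parity_sum !mulr_sumr; congr (_ + _).
  by apply: eq_big => s; rewrite ?eqb_id// => ->.
by apply: eq_big => s; rewrite ?eqbF_neg// => /negbTE ->.
Qed.

Lemma parity_sumD (a b : 'I_n -> R) :
  parity_sum true a b + parity_sum false a b = \prod_(k < n) (a k + b k).
Proof.
have := parity_sumE (fun=> 1) a b; rewrite !mul1r => ->.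
by rewrite prod_expand; apply: eq_bigr => s _; rewrite mul1r.
Qed.

Lemma parity_sumB (a b : 'I_n -> R) :
  parity_sum true a b - parity_sum false a b = \prod_(k < n) (a k - b k).
Proof.
have := parity_sumE (fun p => if p then 1 else -1) a b.
rewrite mul1r mulN1r => ->.
rewrite prod_expand; apply: eq_bigr => s _.
rewrite (_ : (if even_choice s then 1 else -1) =
    \prod_(k < n) (if s k then 1 else -1)); last first.
  rewrite (eq_bigr (fun k => if ~~ s k then -1 else 1)); last first.
    by move=> k _; case: (s k).
  rewrite -big_mkcond/= prodr_const -signr_odd /even_choice.
  by case: odd.
by rewrite -big_split/=; apply: eq_bigr => k _; case: (s k); rewrite ?mul1r ?mulN1r.
Qed.

Lemma parity_sum_ge0 p (a b : 'I_n -> R) :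
  (forall k, 0 <= a k) -> (forall k, 0 <= b k) -> 0 <= parity_sum p a b.
Proof.
by move=> a0 b0; apply: sumr_ge0 => s _; apply: prodr_ge0 => k _; case: ifP.
Qed.

End parity_expansion.

(** * The moment formula for nonnegative integrands *)

Section moment_formula.
Context (R : realType) (X : completePseudoMetricType R).
Hypothesis hausdorffX : hausdorff_space X.
Context (U : nat -> set X) (baseU : is_base U).
Context (lambda : {sigma_finite_measure set (borel X) -> \bar R}).
Context (P : probability (Omega X) R) (c : borel X -> Omega X -> \bar R).
Hypothesis c_density : papangelou_density lambda P c.
Context (n r : nat).
Implicit Types (v : 'I_n -> r.-tuple (borel X) -> Omega X -> R).

Let mass := papangelou_mass_measurable c_density.

Lemma measurable_zrow (rho : grid_partition n r) k :
  measurable_fun setT (fun z : #|val rho|.-tuple (borel X) => zrow rho z k).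
Proof.
apply/measurable_fun_tnthP => l.
rewrite (_ : _ \o _ = fun z => tnth z (zeta rho (k, l))).
  exact: measurable_tnth.
by apply/funext => z /=; rewrite tnth_mktuple.
Qed.

Definition row_product v (rho : grid_partition n r)
    (z : #|val rho|.-tuple (borel X)) (w : Omega X) : R :=
  (\prod_(k < n) v k (zrow rho z k) w)%R.
Arguments row_product : clear implicits.

Lemma measurable_row_product v (rho : grid_partition n r) :
  (forall k, measurable_fun setT
    (fun p : r.-tuple (borel X) * Omega X => v k p.1 p.2)) ->
  measurable_fun setT (fun p : #|val rho|.-tuple (borel X) * Omega X =>
    row_product v rho p.1 p.2).
Proof.
move=> mv; apply: measurable_prod => k _.
exact: (measurableT_comp (mv k) (measurable_fun_pair
  (measurableT_comp (measurable_zrow (rho := rho) k) measurable_fst)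
  measurable_snd)).
Qed.

Lemma measurable_row_product_add v (rho : grid_partition n r) w :
  (forall k, measurable_fun setT
    (fun p : r.-tuple (borel X) * Omega X => v k p.1 p.2)) ->
  measurable_fun setT (fun z : #|val rho|.-tuple (borel X) =>
    row_product v rho z (config_add w z)).
Proof.
move=> mv; exact: (measurableT_comp (measurable_row_product (rho := rho) mv)
  (measurable_shift hausdorffX baseU mass w)).
Qed.

(** The integrands of the [n] factors may differ; positive and negative parts of
    one function will be mixed in this way. *)
Lemma moment_formula_ge0 v : (forall k z w, (0 <= v k z w)%R) ->
  (forall k, measurable_fun setT
    (fun p : r.-tuple (borel X) * Omega X => v k p.1 p.2)) ->
  (forall k (z : r.-tuple (borel X)) w, ~~ uniq z -> v k z w = 0%R) ->
  \int[P]_w \prod_(k < n)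
    (\int[power_measure (config_measure w) r]_z (v k z w)%:E) =
  \sum_(rho : grid_partition n r | nonflat rho)
    \int[P]_w \int[lambda_hat lambda c #|val rho| w]_z
      (row_product v rho z (config_add w z))%:E.
Proof.
move=> v0 mv vu.
have p0 rho z w : 0 <= (row_product v rho z w)%:E.
  by rewrite lee_fin; exact: prodr_ge0.
have mvw k w : measurable_fun setT (fun z => (v k z w)%:E).
  apply/measurable_EFinP; exact: (measurableT_comp (mv k)
    (measurable_fun_pair (@measurable_id _ _ _) (measurable_cst w))).
pose S (rho : grid_partition n r) w :=
  \int[power_measure (config_measure w) #|val rho|]_z
  (if uniq z then (row_product v rho z w)%:E else 0).
have S0 rho w : 0 <= S rho w.
  apply: (integral_config_power_ge0 hausdorffX baseU) => z; by case: ifP.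
have mif (rho : grid_partition n r) : measurable_fun setT
    (fun p : #|val rho|.-tuple (borel X) * Omega X =>
      if uniq p.1 then (row_product v rho p.1 p.2)%:E else 0).
  apply: (measurable_if_uniq hausdorffX baseU) => //.
  by apply/measurable_EFinP; exact: measurable_row_product.
have mS rho : measurable_fun setT (S rho : Omega X -> \bar R).
  apply: (@measurable_integral_config_power _ _ hausdorffX _ baseU mass _ _ _
    id (fun p => if uniq p.2 then (row_product v rho p.2 p.1)%:E else 0)).
  - exact: measurable_id.
  - by move=> p; case: ifP.
  - exact: (measurableT_comp (mif rho)
      (measurable_fun_pair measurable_snd measurable_fst)).
transitivity (\int[P]_w \sum_(rho : grid_partition n r | nonflat rho) S rho w).
  apply: eq_integral => w _.
  under eq_bigr => k _.
    rewrite (integral_config_power hausdorffX baseU)//; last by move=> z; rewrite lee_fin.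
    over.
  rewrite (prod_esum_nonflat (points w : set (borel X))
    (v := fun k z => (v k z w)%:E)).
  - apply: eq_bigr => rho _; rewrite /S (integral_config_power hausdorffX baseU).
    + by apply: eq_esum => z _; rewrite prodEFin.
    + by move=> z; case: ifP.
    + exact: (measurableT_comp (mif rho)
        (measurable_fun_pair (@measurable_id _ _ _) (measurable_cst w))).
  - by move=> k z; rewrite lee_fin.
  - by move=> k z uz; rewrite vu.
under eq_integral do rewrite -big_filter.
rewrite ge0_integral_sum// big_filter; apply: eq_bigr => rho _.
etransitivity.
  apply: (multivariate_campbell hausdorffX baseU c_density
    (F := fun z w => (row_product v rho z w)%:E)); first exact: p0.
  by apply/measurable_EFinP; exact: measurable_row_product.
apply: eq_integral => w _; rewrite (integral_lambda_hat hausdorffX baseU c_density)//.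
by apply/measurable_EFinP; exact: measurable_row_product_add.
Qed.

End moment_formula.
Arguments row_product {R X n r} v rho z w.

(** * The moment formula for signed integrands *)

Section signed_moment.
Context (R : realType) (X : completePseudoMetricType R).
Hypothesis hausdorffX : hausdorff_space X.
Context (U : nat -> set X) (baseU : is_base U).
Context (lambda : {sigma_finite_measure set (borel X) -> \bar R}).
Context (P : probability (Omega X) R) (c : borel X -> Omega X -> \bar R).
Hypothesis c_density : papangelou_density lambda P c.
Context (n r : nat) (n_gt0 : (0 < n)%N).
Context (u : r.-tuple (borel X) -> Omega X -> R).
Hypothesis u_meas : measurable_fun setT
  (fun p : r.-tuple (borel X) * Omega X => u p.1 p.2).
Hypothesis u_diag : forall (z : r.-tuple (borel X)) w, ~~ uniq z -> u z w = 0%R.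

Let mass := papangelou_mass_measurable c_density.

Let part (b : bool) z w : R := Num.max (if b then u z w else - u z w)%R 0%R.

Let part0 b z w : (0 <= part b z w)%R.
Proof. by rewrite /part le_max lexx orbT. Qed.

Let mpart b : measurable_fun setT
  (fun p : r.-tuple (borel X) * Omega X => part b p.1 p.2).
Proof.
apply: measurable_maxr; last exact: measurable_cst.
by case: b => //; exact: measurableT_comp.
Qed.

Let partE z w : part true z w = (if 0 <= u z w then u z w else 0)%R /\
  part false z w = (if 0 <= u z w then 0 else - u z w)%R.
Proof.
rewrite /part; case: ifPn => [u0|]; last rewrite -ltNge => /ltW u0.
  by rewrite max_l//; split=> //; rewrite max_r// oppr_le0.
by rewrite max_r//; split=> //; rewrite max_l// oppr_ge0.
Qed.

Let partB z w : (part true z w - part false z w)%R = u z w.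
Proof.
have [-> ->] := partE z w.
by case: ifP => _; rewrite ?subr0// sub0r opprK.
Qed.

Let partD z w : (part true z w + part false z w)%R = `|u z w|%R.
Proof.
have [-> ->] := partE z w; case: ifPn => [u0|].
  by rewrite addr0 ger0_norm.
by rewrite -ltNge => u0; rewrite add0r ltr0_norm.
Qed.

Let choice_part (s : {ffun 'I_n -> bool}) (k : 'I_n) z w := part (s k) z w.

Let total (w : Omega X) b : \bar R :=
  \int[power_measure (config_measure w) r]_z (part b z w)%:E.

(* The terms of [(total w true - total w false) ^+ n] with sign [+] for
   [p = true], with sign [-] for [p = false]. *)
Let moment_part p (w : Omega X) : \bar R :=
  \sum_(s : {ffun 'I_n -> bool} | even_choice s == p)
    \prod_(k < n) total w (s k).

(* The positive part of the product over the rows, for [p = true], and its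
   negative part; see [hat_parts]. *)
Let row_part p (rho : grid_partition n r) (z : #|val rho|.-tuple (borel X))
    (w : Omega X) : R :=
  parity_sum p (fun k => part true (zrow rho z k) w)
    (fun k => part false (zrow rho z k) w).

Arguments row_part : clear implicits.

Let hat_part p (rho : grid_partition n r) (w : Omega X) : \bar R :=
  \int[lambda_hat lambda c #|val rho| w]_z
    (row_part p rho z (config_add w z))%:E.

Let total_ge0 w b : 0 <= total w b.
Proof.
apply: (integral_config_power_ge0 hausdorffX baseU) => z.
by rewrite lee_fin part0.
Qed.

Let measurable_total b : measurable_fun setT (fun w : Omega X => total w b).
Proof.
apply: (@measurable_integral_config_power _ _ hausdorffX _ baseU mass _ _ _
  id (fun p => (part b p.2 p.1)%:E)).
- exact: measurable_id.
- by move=> p; rewrite lee_fin part0.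
- apply/measurable_EFinP; exact: (measurableT_comp (mpart b)
    (measurable_fun_pair measurable_snd measurable_fst)).
Qed.

Let row_partE p (rho : grid_partition n r) (z : #|val rho|.-tuple (borel X)) w :
  row_part p rho z w =
  (\sum_(s : {ffun 'I_n -> bool} | even_choice s == p)
    row_product (choice_part s) rho z w)%R.
Proof.
apply: eq_bigr => s _; apply: eq_bigr => k _.
by rewrite /choice_part; case: (s k).
Qed.

Let row_part_ge0 p (rho : grid_partition n r) (z : #|val rho|.-tuple (borel X))
    w : (0 <= row_part p rho z w)%R.
Proof. by apply: parity_sum_ge0 => k; exact: part0. Qed.

Let measurable_row_part p (rho : grid_partition n r) : measurable_fun setT
  (fun q : #|val rho|.-tuple (borel X) * Omega X => (row_part p rho q.1 q.2)%:E).
Proof.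
apply/measurable_EFinP.
rewrite (_ : (fun _ => _) = fun q : #|val rho|.-tuple (borel X) * Omega X =>
    \sum_(s <- [seq s <- index_enum {ffun 'I_n -> bool} | even_choice s == p])
      row_product (choice_part s) rho q.1 q.2)%R; last first.
  by apply/funext => q; rewrite row_partE big_filter.
apply: measurable_sum => s; apply: measurable_row_product => k.
exact: mpart.
Qed.

Let row_partB (rho : grid_partition n r) (z : #|val rho|.-tuple (borel X)) w :
  (row_part true rho z w - row_part false rho z w =
  row_product (fun=> u) rho z w)%R.
Proof. by rewrite parity_sumB; apply: eq_bigr => k _; rewrite partB. Qed.

Let row_partD (rho : grid_partition n r) (z : #|val rho|.-tuple (borel X)) w :
  (row_part true rho z w + row_part false rho z w =
  \prod_(k < n) `|u (zrow rho z k) w|)%R.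
Proof. by rewrite parity_sumD; apply: eq_bigr => k _; rewrite partD. Qed.

Let hat_part_ge0 p rho w : 0 <= hat_part p rho w.
Proof.
rewrite /hat_part.
have [m -> _] := lambda_hat_measure hausdorffX baseU c_density w #|val rho|.
by apply: integral_ge0 => z _; rewrite lee_fin.
Qed.

Let measurable_hat_part p rho :
  measurable_fun setT (hat_part p rho : Omega X -> \bar R).
Proof.
apply: (measurable_integral_lambda_hat hausdorffX baseU c_density
  (f := fun (z : #|val rho|.-tuple (borel X)) w => (row_part p rho z w)%:E)) => //.
by move=> z w; rewrite lee_fin.
Qed.

Let moment_part_ge0 p w : 0 <= moment_part p w.
Proof. by apply: sume_ge0 => s _; exact: prode_ge0. Qed.

Let measurable_moment_part p :
  measurable_fun setT (moment_part p : Omega X -> \bar R).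
Proof.
rewrite (_ : moment_part p = fun w : Omega X =>
    \sum_(s <- [seq s <- index_enum {ffun 'I_n -> bool} | even_choice s == p])
      \prod_(k < n) total w (s k)); last first.
  by apply/funext => w; rewrite big_filter.
by apply: emeasurable_sum => s; apply: emeasurable_prod => k.
Qed.

Let integral_moment_part p : \int[P]_w moment_part p w =
  \sum_(rho : grid_partition n r | nonflat rho) \int[P]_w hat_part p rho w.
Proof.
rewrite /moment_part; under eq_integral do rewrite -big_filter.
rewrite ge0_integral_sum//; last 2 first.
- by move=> s; apply: emeasurable_prod => k.
- by move=> s w _; exact: prode_ge0.
rewrite big_filter.
have mchoice s k : measurable_fun setT
    (fun q : r.-tuple (borel X) * Omega X => choice_part s k q.1 q.2).
  exact: mpart.
transitivity (\sum_(s : {ffun 'I_n -> bool} | even_choice s == p)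
    \sum_(rho : grid_partition n r | nonflat rho)
      \int[P]_w \int[lambda_hat lambda c #|val rho| w]_z
        (row_product (choice_part s) rho z (config_add w z))%:E).
  apply: eq_bigr => s _.
  apply: (moment_formula_ge0 hausdorffX baseU c_density (v := choice_part s)) => //.
  - by move=> k z w; exact: part0.
  - move=> k z w zu; rewrite /choice_part /part u_diag// oppr0.
    by case: ifP; rewrite maxxx.
rewrite exchange_big/=; apply: eq_bigr => rho _.
rewrite -big_filter.
rewrite -ge0_integral_sum//; last 2 first.
- move=> s; apply: (measurable_integral_lambda_hat hausdorffX baseU c_density
    (f := fun (z : #|val rho|.-tuple (borel X)) w => (row_product (choice_part s) rho z w)%:E)).
    by move=> z w; rewrite lee_fin; apply: prodr_ge0 => k _; exact: part0.
  by apply/measurable_EFinP; exact: measurable_row_product.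
- move=> s w _.
  have [m -> _] := lambda_hat_measure hausdorffX baseU c_density w #|val rho|.
  by apply: integral_ge0 => z _; rewrite lee_fin; apply: prodr_ge0 => k _; exact: part0.
apply: eq_integral => w _; rewrite /hat_part.
have [m -> _] := lambda_hat_measure hausdorffX baseU c_density w #|val rho|.
rewrite -ge0_integral_sum//; last 2 first.
- move=> s; apply/measurable_EFinP.
  exact: (measurable_row_product_add hausdorffX baseU c_density).
- by move=> s z _; rewrite lee_fin; apply: prodr_ge0 => k _; exact: part0.
by apply: eq_integral => z _; rewrite row_partE sumEFin big_filter.
Qed.

Let abs_part (rho : grid_partition n r) (w : Omega X) : \bar R :=
  \int[lambda_hat lambda c #|val rho| w]_z
    (\prod_(k < n) `|u (zrow rho z k) (config_add w z)|)%R%:E.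

Hypothesis u_sense : \sum_(rho : grid_partition n r | nonflat rho)
  \int[P]_w abs_part rho w < +oo.

(* The domination that makes every other integral below finite. *)
Let abs_partE rho w : abs_part rho w = hat_part true rho w + hat_part false rho w.
Proof.
rewrite /abs_part /hat_part.
have mrow p : measurable_fun setT (fun z : #|val rho|.-tuple (borel X) =>
    (row_part p rho z (config_add w z))%:E).
  exact: (measurableT_comp (@measurable_row_part p rho)
    (measurable_shift hausdorffX baseU mass w)).
have [m -> _] := lambda_hat_measure hausdorffX baseU c_density w #|val rho|.
rewrite -ge0_integralD//; last 2 first.
- by move=> z _; rewrite lee_fin.
- by move=> z _; rewrite lee_fin.
by apply: eq_integral => z _; rewrite -EFinD row_partD.
Qed.

Let integrable_hat_part p rho : nonflat rho ->
  P.-integrable setT (hat_part p rho : Omega X -> \bar R).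
Proof.
move=> nf; apply/integrableP; split; first exact: measurable_hat_part.
apply: le_lt_trans u_sense; rewrite (bigD1 rho)//=.
apply: (@le_trans _ _ (\int[P]_w abs_part rho w)); last first.
  rewrite leeDl//; apply: sume_ge0 => rho' _; apply: integral_ge0 => w _.
  by rewrite abs_partE adde_ge0.
apply: ge0_le_integral => //.
- by apply: measurableT_comp => //; exact: measurable_hat_part.
- rewrite (_ : abs_part rho = hat_part true rho \+ hat_part false rho).
    by apply: emeasurable_funD; exact: measurable_hat_part.
  by apply/funext => w; exact: abs_partE.
- by move=> w _; rewrite gee0_abs// abs_partE; case: p; [rewrite leeDl|rewrite leeDr].
Qed.

Let integrable_moment_part p : P.-integrable setT (moment_part p : Omega X -> \bar R).
Proof.
apply/integrableP; split; first exact: measurable_moment_part.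
under eq_integral do rewrite gee0_abs//.
rewrite integral_moment_part; apply: lte_sum_pinfty => rho nf.
exact: integrable_lty (integrable_hat_part p nf).
Qed.

(* The [n]-th power of each total mass is a term of one of the two sums. *)
Let moment_part_total (w : Omega X) b : moment_part true w < +oo ->
  moment_part false w < +oo -> total w b \is a fin_num.
Proof.
move=> Lt Lf; rewrite ge0_fin_numE//.
have : total w b ^+ n < +oo.
  pose s := [ffun _ : 'I_n => b].
  have : moment_part (even_choice s) w < +oo by case: even_choice.
  apply: le_lt_trans; rewrite /moment_part (bigD1 s)//=.
  rewrite (eq_bigr (fun=> total w b)) ?prode_const; last by move=> k _; rewrite ffunE.
  by rewrite leeDl//; apply: sume_ge0 => s' _; exact: prode_ge0.
rewrite !ltey; apply: contra_neq => ->.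
by case: n n_gt0 => // k _; rewrite expeS; elim: k => [|k IH]; rewrite ?mule1// expeS IH.
Qed.

Let moment_partB (w : Omega X) : moment_part true w \is a fin_num ->
  moment_part false w \is a fin_num ->
  (total w true - total w false) ^+ n = moment_part true w - moment_part false w.
Proof.
move=> Lt Lf.
have tot b : total w b \is a fin_num.
  by apply: moment_part_total; rewrite -ge0_fin_numE.
have LE p : moment_part p w = (parity_sum p
    (fun _ : 'I_n => fine (total w true)) (fun _ : 'I_n => fine (total w false)))%:E.
  rewrite -sumEFin; apply: eq_bigr => s _; rewrite -prodEFin.
  by apply: eq_bigr => k _; case: (s k); rewrite fineK.
rewrite !LE -EFinB parity_sumB prodr_const card_ord.
by rewrite -(fineK (tot true)) -(fineK (tot false)) -EFinB -EFin_expe.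
Qed.

Let total_parts (w : Omega X) :
  \int[power_measure (config_measure w) r]_z (u z w)%:E =
  total w true - total w false.
Proof.
rewrite /total.
have [mm <-] := config_sigma_finite_measure hausdorffX baseU w.
have [m ->] := power_measure_sigma_finite mm r.
rewrite integralE; congr (_ - _); apply: eq_integral => z _.
  by rewrite funeposE -EFin_max.
by rewrite funenegE -EFinN -EFin_max.
Qed.

Let hat_parts (rho : grid_partition n r) (w : Omega X) :
  \int[lambda_hat lambda c #|val rho| w]_z
    (row_product (fun=> u) rho z (config_add w z))%:E =
  hat_part true rho w - hat_part false rho w.
Proof.
rewrite /hat_part.
have [m -> _] := lambda_hat_measure hausdorffX baseU c_density w #|val rho|.
have E (z : #|val rho|.-tuple (borel X)) w' : 
  Num.max (row_product (fun=> u) rho z w') 0%R = row_part true rho z w' /\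
  Num.max (- row_product (fun=> u) rho z w')%R 0%R = row_part false rho z w'.
  rewrite -row_partB; apply: max_of_norm; [exact: row_part_ge0..|].
  by rewrite row_partB row_partD /row_product normr_prod.
rewrite integralE; congr (_ - _); apply: eq_integral => z _.
  by rewrite funeposE -EFin_max (E _ _).1.
by rewrite funenegE -EFinN -EFin_max (E _ _).2.
Qed.

(** The two nonnegative identities for [moment_part true] and [moment_part false]
    are subtracted.  Outside a null set both moments are finite, and there their
    difference is the power on the left. *)
Lemma moment_formula_signed :
  \int[P]_w (\int[power_measure (config_measure w) r]_z (u z w)%:E) ^+ n =
  \sum_(rho : grid_partition n r | nonflat rho)
    \int[P]_w \int[lambda_hat lambda c #|val rho| w]_z
      (row_product (fun=> u) rho z (config_add w z))%:E.
Proof.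
have hfin p rho : nonflat rho -> \int[P]_w hat_part p rho w \is a fin_num.
  by move=> nf; exact: integrable_fin_num (integrable_hat_part p nf).
transitivity (\int[P]_w (moment_part true w - moment_part false w)).
  apply: ae_eq_integral => //.
  - rewrite (_ : (fun _ => _) = fun w : Omega X =>
        \prod_(k < n) (total w true - total w false)).
      by apply: emeasurable_prod => k; apply: emeasurable_funB; exact: measurable_total.
    by apply/funext => w; rewrite total_parts prode_const.
  - by apply: emeasurable_funB; exact: measurable_moment_part.
  have := integrable_ae measurableT (integrable_moment_part true).
  have := integrable_ae measurableT (integrable_moment_part false).
  apply: filterS2 => w Lf Lt _.
  by rewrite total_parts moment_partB//; [exact: Lt|exact: Lf].
rewrite [LHS]integralB//.
rewrite !integral_moment_part.
transitivity (\sum_(rho : grid_partition n r | nonflat rho)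
  (\int[P]_w hat_part true rho w - \int[P]_w hat_part false rho w)).
  rewrite [X in _ + X](_ : _ = \sum_(rho : grid_partition n r | nonflat rho)
      - \int[P]_w hat_part false rho w).
    exact/esym/big_split.
  by rewrite fin_num_sumeN// => rho; exact: hfin.
apply: eq_bigr => rho nf.
rewrite -integralB//; [|exact: integrable_hat_part..].
by apply: eq_integral => w _; rewrite hat_parts.
Qed.

End signed_moment.

(** * The joint moment identity *)

Theorem proposition2p3 (R : realType) (X : completePseudoMetricType R)
    (hausdorffX : hausdorff_space X) (separableX : separable_space X)
    (lambda : {sigma_finite_measure set (borel X) -> \bar R})
    (lambda_non_atomic : non_atomic lambda)
    (P : probability (Omega X) R)
    (c : borel X -> Omega X -> \bar R)
    (c_density : papangelou_density lambda P c)
    (n r : nat) (n_gt0 : (0 < n)%N) (r_gt0 : (0 < r)%N)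
    (u : r.-tuple (borel X) -> Omega X -> R)
    (u_measurable : measurable_fun setT
      (fun p : r.-tuple (borel X) * Omega X => u p.1 p.2))
    (u_diag : forall z w (i j : 'I_r), i != j -> tnth z i = tnth z j ->
      u z w = 0%R)
    (u_sense : (forall z w, (0 <= u z w)%R) \/
      \sum_(rho : grid_partition n r | nonflat rho)
        \int[P]_w \int[lambda_hat lambda c #|val rho| w]_z
          (eps_plus z (fun w' => \prod_(k < n) `|u (zrow rho z k) w'|) w)%R%:E
      < +oo) :
  \int[P]_w (\int[power_measure (config_measure w) r]_z (u z w)%:E) ^+ n =
  \sum_(rho : grid_partition n r | nonflat rho)
    \int[P]_w \int[lambda_hat lambda c #|val rho| w]_z
      (eps_plus z (fun w' => \prod_(k < n) u (zrow rho z k) w') w)%R%:E.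
Proof.
have [U baseU] := separable_base separableX.
have u0 (z : r.-tuple (borel X)) w : ~~ uniq z -> u z w = 0%R.
  move=> nz; apply: contrapT => uz; move/negP: nz; apply; apply/tuple_uniqP.
  move=> i j ij; apply/eqP; apply: contrapT => /negP nij.
  by apply: uz; exact: u_diag nij ij.
case: u_sense => [u_ge0|u_fin]; last first.
  exact: (moment_formula_signed hausdorffX baseU c_density n_gt0 u_measurable
    u0 u_fin).
transitivity (\int[P]_w \prod_(k < n)
    (\int[power_measure (config_measure w) r]_z (u z w)%:E)).
  by apply: eq_integral => w _; rewrite prode_const.
exact: (moment_formula_ge0 hausdorffX baseU c_density (v := fun=> u)).
Qed.
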